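(* Let $f\in\mathbb C[x_1,\dots,x_n]$ be nonzero, let $\ell\in\mathbb Z$ and $\omega\in\mathbb R^n\setminus\{0\}$. Then: (i) $\ell\,\mathrm{ord}_f(\omega)$ is a root of $b_{\mathrm{Ann}(f^\ell),\omega}(s)$; (ii) if $\ell\in\mathbb N$, then $b_{\mathrm{Ann}(f^\ell),\omega}(s)=s-\ell\,\mathrm{ord}_f(\omega)$.
   Context: $D_n=\mathbb C[x_1,\dots,x_n,\partial_1,\dots,\partial_n]$ is the $n$-th Weyl algebra ($\partial_ix_j=x_j\partial_i+\delta_{ij}$, all other pairs of generators commute); ''ideal'' means left ideal. Every $P\in D_n$ has a unique normally ordered expression $P=\sum c_{\alpha\beta}x^\alpha\partial^\beta$ (multi-index notation). For $\omega\in\mathbb R^n$, the $(-\omega,\omega)$-weight of $x^\alpha\partial^\beta$ is $-\langle\omega,\alpha\rangle+\langle\omega,\beta\rangle$; $\mathrm{in}_{(-\omega,\omega)}(P)$ is the sum of the terms of $P$ of maximal weight, and for an ideal $I$, $\mathrm{in}_{(-\omega,\omega)}(I)$ is the left ideal generated by all $\mathrm{in}_{(-\omega,\omega)}(P)$, $P\in I\setminus\{0\}$. For a holonomic ideal $I$ and $\omega\in\mathbb R^n\setminus\{0\}$ put $s=\omega_1x_1\partial_1+\dots+\omega_nx_n\partial_n$; the b-function $b_{I,\omega}(s)$ is the monic generator of the (nonzero) ideal $\mathrm{in}_{(-\omega,\omega)}(I)\cap\mathbb C[s]$ of the polynomial ring $\mathbb C[s]$. Standing assumption: $\mathrm{in}_{(-\omega,\omega)}(I)\neq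 D_n$ for the ideals and weights considered. $D_n$ acts on functions by $x_i\bullet g=x_ig$, $\partial_i\bullet g=\partial g/\partial x_i$ (so $\partial_i\bullet f^\ell=\ell f^{\ell-1}\partial f/\partial x_i$); for nonzero $f\in\mathbb C[x_1,\dots,x_n]$ and $\ell\in\mathbb C$, $\mathrm{Ann}(f^\ell)=\{P\in D_n:P\bullet f^\ell=0\}$, a holonomic ideal; $\mathrm{Ann}(1/f^\ell)$ denotes $\mathrm{Ann}(f^{-\ell})$. For $f=\sum_\gamma c_\gamma x^\gamma$: $\mathrm{Supp}(f)=\{\gamma:c_\gamma\ne0\}$, $\Gamma(f)$ is its convex hull, and $\mathrm{ord}_f(\omega)=\min\{\langle\gamma,\omega\rangle:\gamma\in\Gamma(f)\}$. $\mathbb N=\{0,1,2,\dots\}$. *)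

(* Defs.v *)
From HB Require Import structures.
From mathcomp Require Import all_boot all_order all_algebra.
From mathcomp Require Import reals.
From mathcomp Require Import complex.
From mathcomp Require Import mpoly.

Set Implicit Arguments.
Unset Strict Implicit.
Unset Printing Implicit Defensive.

Import Order.TTheory GRing.Theory Num.Theory.
Local Open Scope ring_scope.
Local Notation "x %:F" := (@FracField.tofrac _ x) : ring_scope.

Definition toC (R : realType) (x : R) : R[i] := (x%:C)%C.

Section Weyl.
Variables (R : realType) (n : nat).
Local Notation C := (R[i]).

(* The Weyl algebra D_n, represented by normally ordered expressions:       *)
(* an element  sum c_{ab} x^a d^b  is stored as a (commutative) polynomial   *)
(* in 2n variables, variable (lshift n i) standing for x_i and variable      *)
(* (rshift n i) standing for d_i.  The (noncommutative) Weyl product is      *)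
(* defined below from the relations  d_i x_j = x_j d_i + delta_ij.           *)
Definition weyl := {mpoly C[n + n]}.

Definition xidx (i : 'I_n) : 'I_(n + n) := lshift n i.
Definition didx (i : 'I_n) : 'I_(n + n) := rshift n i.
Definition xexp (m : 'X_{1..n + n}) (i : 'I_n) : nat := m (xidx i).
Definition dexp (m : 'X_{1..n + n}) (i : 'I_n) : nat := m (didx i).

Definition lmul_x (i : 'I_n) (P : weyl) : weyl := 'X_(xidx i) * P.

(* left multiplication by d_i :  d_i * x^a d^b = x^a d^(b+e_i) + a_i x^(a-e_i) d^b,
   extended linearly *)
Definition lmul_d (i : 'I_n) (P : weyl) : weyl :=
  \sum_(m <- msupp P)
     P@_m *: ('X_[(m + U_(didx i))%MM]
              + (xexp m i)%:R *: 'X_[(m - U_(xidx i))%MM]).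

Definition wmul (P Q : weyl) : weyl :=
  \sum_(m <- msupp P)
     P@_m *: foldr (fun i Q' => iter (xexp m i) (lmul_x i) Q')
                   (foldr (fun i Q' => iter (dexp m i) (lmul_d i) Q') Q (enum 'I_n))
                   (enum 'I_n).

Definition wpow (S : weyl) (k : nat) : weyl := iter k (wmul S) 1.

Definition peval (p : {poly C}) (S : weyl) : weyl :=
  \sum_(k < size p) p`_k *: wpow S k.

Definition lgen (S : weyl -> Prop) (Q : weyl) : Prop :=
  exists s : seq (weyl * weyl),
    (forall a, a \in s -> S a.2) /\ Q = \sum_(a <- s) wmul a.1 a.2.

Definition wt (w : 'I_n -> R) (m : 'X_{1..n + n}) : R :=
  \sum_(i < n) w i * ((dexp m i)%:R - (xexp m i)%:R).

Definition initf (w : 'I_n -> R) (P : weyl) : weyl :=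
  \sum_(m <- msupp P | all (fun m' => wt w m' <= wt w m) (msupp P)) P@_m *: 'X_[m].

Definition initI (w : 'I_n -> R) (I : weyl -> Prop) : weyl -> Prop :=
  lgen (fun Q => exists P, I P /\ P != 0 /\ Q = initf w P).

Definition s_op (w : 'I_n -> R) : weyl :=
  \sum_(i < n) toC (w i) *: ('X_(xidx i) * 'X_(didx i)).

Definition is_bfun (I : weyl -> Prop) (w : 'I_n -> R) (b : {poly C}) : Prop :=
  b \is monic /\ forall p : {poly C}, initI w I (peval p (s_op w)) <-> (b %| p).

Definition ratfun := {fraction {mpoly C[n]}}.

Definition dfrac (i : 'I_n) (u : ratfun) : ratfun :=
  let r := repr u in
  ((\n_r)^`M(i) * \d_r - \n_r * (\d_r)^`M(i))%:F / (\d_r * \d_r)%:F.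

Definition act (P : weyl) (u : ratfun) : ratfun :=
  \sum_(m <- msupp P)
     (P@_m)%:MP%:F * (\prod_(i < n) ('X_i)%:F ^+ xexp m i)
       * foldr (fun i v => iter (dexp m i) (dfrac i) v) u (enum 'I_n).

Definition Ann (f : {mpoly C[n]}) (l : int) : weyl -> Prop :=
  fun P => act P ((f%:F) ^ l) = 0.

Definition inGamma (f : {mpoly C[n]}) (g : 'I_n -> R) : Prop :=
  exists lam : 'X_{1..n} -> R,
    (forall m, 0 <= lam m) /\ \sum_(m <- msupp f) lam m = 1 /\
    forall i, g i = \sum_(m <- msupp f) lam m * (m i)%:R.

Definition dotR (g w : 'I_n -> R) : R := \sum_(i < n) g i * w i.

Definition is_ordf (f : {mpoly C[n]}) (w : 'I_n -> R) (o : R) : Prop :=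
  (exists g, inGamma f g /\ dotR g w = o) /\
  (forall g, inGamma f g -> o <= dotR g w).

End Weyl.

(* Main.v *)
Require Import Defs.
From HB Require Import structures.
From mathcomp Require Import all_boot all_order all_algebra.
From mathcomp Require Import reals.
From mathcomp Require Import complex.
From mathcomp Require Import mpoly.
From mathcomp Require Import boolp ring zify.
Import Order.TTheory GRing.Theory Num.Theory.
Local Open Scope ring_scope.

Set Implicit Arguments.
Unset Strict Implicit.
Unset Printing Implicit Defensive.

(* Let h be the sum of the terms of f of minimal weight o = ord_f(w).
   - If P annihilates f^l, comparing terms of extreme weight shows that in(P)
     annihilates h^l, and s acts on h^l as the scalar l o. Hence p(s) in in(Ann(f^l))
     forces p(l o) = 0.
   - For l >= 0 put g = f^l. The polynomial (s - l o).g only has monomials x^d of weight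
     > l o, and each of them is R.g for some R of negative weight: isolate a monomial x^c
     of g of weight l o, apply d^c, multiply by x^d. Subtracting these operators from
     s - l o gives an annihilator of g with initial form s - l o.
   - For l < 0 what is missing is a nonzero p with p(s) in J = in(Ann(f^l)). The order-k
     part of D/Ann(f^l) consists of fractions with denominator f^(k-l) and numerator of
     degree O(k), so it has dimension O(k^n), and passing to initial forms gives the same
     bound for D/J. As J is stable under right multiplication by s, operators
     sum_i P_i s^i act on D/J; if no p(s) were in J, those with P_i of order <= k would
     embed into the linear maps from the order-k part to the order-(k + 2q + k) part of
     D/J (take commutators with the generators, as in Bernstein's inequality). For
     i <= q ~ k this contradicts k^(2n) k >> k^n k^n. *)

(** * Linear maps and linear extension from monomials *)

Section LinearMaps.
Variables (K : nzRingType) (E F : lmodType K).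
Implicit Types (f : E -> F).

Lemma lin0 f : linear f -> f 0 = 0.
Proof.
move=> lf; have := lf 1 0 0; rewrite !scale1r addr0 => /eqP.
by rewrite -subr_eq0 opprD addNKr oppr_eq0 => /eqP.
Qed.

Lemma linZ f : linear f -> forall a u, f (a *: u) = a *: f u.
Proof. by move=> lf a u; have := lf a u 0; rewrite lin0 // !addr0. Qed.

Lemma linD f : linear f -> {morph f : u v / u + v}.
Proof. by move=> lf u v; have := lf 1 u v; rewrite !scale1r. Qed.

Lemma lin_sum f (I : Type) (s : seq I) (P : pred I) (c : I -> K) (g : I -> E) :
  linear f ->
  f (\sum_(i <- s | P i) c i *: g i) = \sum_(i <- s | P i) c i *: f (g i).
Proof.
move=> lf; elim: s => [|i s IH]; first by rewrite !big_nil lin0.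
by rewrite !big_cons; case: ifP => // _; rewrite lf IH.
Qed.

Lemma lin_sum1 f (I : Type) (s : seq I) (P : pred I) (g : I -> E) :
  linear f -> f (\sum_(i <- s | P i) g i) = \sum_(i <- s | P i) f (g i).
Proof. by move=> lf; apply: (big_morph f (linD lf) (lin0 lf)). Qed.

End LinearMaps.

Section LinearExtension.
Variables (K : nzRingType) (k : nat) (E : lmodType K).
Implicit Types (P Q : {mpoly K[k]}) (g : 'X_{1..k} -> E).

Definition lext g P : E := \sum_(m <- msupp P) P@_m *: g m.

(** Any duplicate-free list containing the support may index the sum; two polynomials can then be
    expanded over one list, which additivity requires. *)
Lemma lext_sup g P (s : seq 'X_{1..k}) :
  uniq s -> {subset msupp P <= s} -> lext g P = \sum_(m <- s) P@_m *: g m.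
Proof.
move=> us sub; rewrite [RHS](bigID (mem (msupp P))) /= [X in _ + X]big1 ?addr0.
  rewrite -big_filter; apply: perm_big; apply: uniq_perm.
  - exact: msupp_uniq.
  - exact: filter_uniq.
  by move=> m; rewrite mem_filter /=; case: (boolP (m \in msupp P)) => // /sub ->.
by move=> m hm; rewrite memN_msupp_eq0 // scale0r.
Qed.

Lemma lext_linear g : linear (lext g).
Proof.
move=> a P Q.
pose s := undup (msupp P ++ msupp Q).
have us : uniq s by apply: undup_uniq.
have sP : {subset msupp P <= s}.
  by move=> m hm; rewrite mem_undup mem_cat hm.
have sQ : {subset msupp Q <= s}.
  by move=> m hm; rewrite mem_undup mem_cat hm orbT.
rewrite (lext_sup _ us sP) (lext_sup _ us sQ) (@lext_sup _ _ s us); last first.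
  move=> m /msuppD_le; rewrite mem_cat => /orP [/msuppZ_le /sP //|/sQ //].
rewrite scaler_sumr -big_split /=; apply: eq_bigr => m _.
by rewrite mcoeffD mcoeffZ scalerDl scalerA.
Qed.

Lemma lextX g m : lext g 'X_[m] = g m.
Proof. by rewrite /lext msuppX big_seq1 mcoeffX eqxx scale1r. Qed.

Lemma eq_lin_mpoly (f h : {mpoly K[k]} -> E) : linear f -> linear h ->
  (forall m, f 'X_[m] = h 'X_[m]) -> f =1 h.
Proof.
move=> lf lh fh P; rewrite [P]mpolyE (lin_sum _ _ _ _ lf) (lin_sum _ _ _ _ lh).
by apply: eq_bigr => m _; rewrite fh.
Qed.

End LinearExtension.

(** * Modules over the Weyl algebra, presented by operators *)

Section IteratedOperators.
Variables (I : eqType) (E : Type) (T : I -> E -> E).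

(** Kept in the [foldr]-of-[iter] form of [wmul] and [act], so that these can later be matched with
    it by conversion. *)
Definition fop (e : I -> nat) (s : seq I) (u : E) : E :=
  foldr (fun i v => iter (e i) (T i) v) u s.

Lemma iter_comm (f g : E -> E) k u :
  (forall v, f (g v) = g (f v)) -> f (iter k g u) = iter k g (f u).
Proof. by move=> fg; elim: k => //= k IH; rewrite fg IH. Qed.

Lemma fop_comm (f : E -> E) e s u :
  (forall i v, i \in s -> f (T i v) = T i (f v)) -> f (fop e s u) = fop e s (f u).
Proof.
elim: s u => //= j s IH u fT.
rewrite iter_comm; last by move=> v; apply: fT; rewrite mem_head.
by rewrite IH // => i v hi; apply: fT; rewrite inE hi orbT.
Qed.

Lemma eq_fop e e' s u : {in s, e =1 e'} -> fop e s u = fop e' s u.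
Proof.
elim: s => //= j s IH ee'; rewrite ee' ?mem_head // IH // => i hi.
by apply: ee'; rewrite inE hi orbT.
Qed.

Lemma fop0 e s u : {in s, forall i, e i = 0%N} -> fop e s u = u.
Proof.
elim: s => //= j s IH e0; rewrite e0 ?mem_head //= IH // => i hi.
by apply: e0; rewrite inE hi orbT.
Qed.

Lemma fopS e e' s i u :
  (forall a b v, T a (T b v) = T b (T a v)) -> uniq s -> i \in s ->
  (forall j, e' j = (e j + (j == i))%N) -> fop e' s u = T i (fop e s u).
Proof.
move=> TT + + ee'; elim: s => //= j s IH /andP [js us].
rewrite ee' inE; have [ij|ne] := eqVneq i j => /= [_|his].
  subst j; rewrite addn1 /=; congr (T i (iter _ _ _)).
  apply: eq_fop => a ha; rewrite ee'; case: eqP => [ai|_]; rewrite ?addn0 //.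
  by rewrite -ai ha in js.
by rewrite addn0 IH // iter_comm.
Qed.

End IteratedOperators.

Section WeylRepresentations.
Variables (K : comNzRingType) (n : nat).

(** A left module over the Weyl algebra. The interface is instantiated by the algebra itself, by
    polynomials and by rational functions. *)
Record weyl_rep (E : lmodType K) (X D : 'I_n -> E -> E) : Prop := WeylRep {
  rep_linX : forall i, linear (X i);
  rep_linD : forall i, linear (D i);
  rep_XX : forall i j u, X i (X j u) = X j (X i u);
  rep_DD : forall i j u, D i (D j u) = D j (D i u);
  rep_DX : forall i j u, D i (X j u) = X j (D i u) + (i == j)%:R *: u
}.

Definition mop (E : Type) (X D : 'I_n -> E -> E) (m : 'X_{1..n + n}) (u : E) : E :=
  fop X (xexp m) (enum 'I_n) (fop D (dexp m) (enum 'I_n) u).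

Definition ev (E : lmodType K) (X D : 'I_n -> E -> E) (P : {mpoly K[n + n]})
  (u : E) : E := lext (fun m => mop X D m u) P.

Section OneRep.
Variables (E : lmodType K) (X D : 'I_n -> E -> E).

Lemma fop_linear (T : 'I_n -> E -> E) e s :
  (forall i, linear (T i)) -> linear (fop T e s).
Proof.
move=> lT; elim: s => [//|j s IH] a u v.
rewrite /fop /= -!/(fop T e s _) IH.
by elim: (e j) => //= k ->; rewrite lT.
Qed.

Hypothesis rep : weyl_rep X D.

Lemma mop_linear m : linear (mop X D m).
Proof.
move=> a u v; rewrite /mop (fop_linear _ _ (rep_linD rep)).
by rewrite (fop_linear _ _ (rep_linX rep)).
Qed.

Lemma ev_linear_r P : linear (ev X D P).
Proof.
move=> a u v; rewrite /ev /lext scaler_sumr -big_split /=; apply: eq_bigr => m _.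
by rewrite mop_linear scalerDr !scalerA mulrC.
Qed.

Lemma ev_linear_l u : linear (fun P => ev X D P u).
Proof. exact: lext_linear. Qed.

Lemma evX m u : ev X D 'X_[m] u = mop X D m u.
Proof. exact: lextX. Qed.

Lemma mop0 u : mop X D 0%MM u = u.
Proof. by rewrite /mop !fop0 // => i _; rewrite /xexp /dexp mnm0E. Qed.

Lemma ev1 u : ev X D 1 u = u.
Proof. by rewrite -[1]mpolyX0 evX mop0. Qed.

Lemma mop_addx m i u : mop X D (m + U_(xidx i))%MM u = X i (mop X D m u).
Proof.
rewrite /mop; rewrite -(@fopS _ _ _ _ (xexp (m + U_(xidx i))%MM) _ i) ?enum_uniq ?mem_enum //.
- congr fop; apply: eq_fop => j _.
  by rewrite /dexp mnmDE mnm1E /xidx /didx eq_lrshift addn0.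
- exact: (rep_XX rep).
by move=> j; rewrite /xexp mnmDE mnm1E eq_lshift eq_sym.
Qed.

(** Iterating [D, X] = 1. At k = 0 the truncated exponent [k.-1] is harmless, since its coefficient
    is 0. *)
Lemma D_iterX i k u :
  D i (iter k (X i) u) = iter k (X i) (D i u) + k%:R *: iter k.-1 (X i) u.
Proof.
elim: k => [|k IH] /=; first by rewrite scale0r addr0.
rewrite (rep_DX rep) IH (linD (rep_linX rep _)) (linZ (rep_linX rep _)) eqxx scale1r.
rewrite -addrA; congr (_ + _); case: k {IH} => [|k] /=.
  by rewrite scale0r add0r scale1r.
by rewrite -[in RHS]natr1 scalerDl scale1r.
Qed.

(** [D i] passes freely through every [X j] with j != i, so only the block of powers of [X i]
    produces a correction term. *)
Lemma D_fopX i e e' s u : uniq s -> i \in s ->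
  (forall j, e' j = (e j - (j == i))%N) ->
  D i (fop X e s u) = fop X e s (D i u) + (e i)%:R *: fop X e' s u.
Proof.
move=> + + ee'; have DXc j v : j != i -> D i (X j v) = X j (D i v).
  by move=> ne; rewrite (rep_DX rep) eq_sym (negPf ne) scale0r addr0.
elim: s => //= j s IH /andP [js us].
rewrite ee' inE; have [ij|ne] := eqVneq i j => /= [_|his].
  subst j; rewrite subn1 D_iterX fop_comm.
    congr (_ + _ *: iter _ _ _); apply: eq_fop => a ha; rewrite ee'.
    case: eqP => [ai|_]; rewrite ?subn0 //.
    by rewrite -ai ha in js.
  by move=> a v ha; apply: DXc; apply: contra js => /eqP <-.
rewrite subn0 iter_comm; last by move=> v; apply: DXc; rewrite eq_sym.
rewrite IH //; elim: (e j) => //= k ->.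
by rewrite (linD (rep_linX rep _)) (linZ (rep_linX rep _)).
Qed.

Lemma D_mop m i u : D i (mop X D m u) =
  mop X D (m + U_(didx i))%MM u + (xexp m i)%:R *: mop X D (m - U_(xidx i))%MM u.
Proof.
rewrite /mop (@D_fopX i _ (xexp (m - U_(xidx i))%MM)) ?enum_uniq ?mem_enum //; last first.
  by move=> j; rewrite /xexp mnmBE mnm1E eq_lshift eq_sym.
congr (_ + _ *: _).
  rewrite -(@fopS _ _ _ _ (dexp (m + U_(didx i))%MM) _ i) ?enum_uniq ?mem_enum //.
  - apply: eq_fop => j _.
    by rewrite /xexp mnmDE mnm1E /xidx /didx eq_rlshift addn0.
  - exact: (rep_DD rep).
  by move=> j; rewrite /dexp mnmDE mnm1E eq_rshift eq_sym.
congr fop; apply: eq_fop => j _.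
by rewrite /dexp mnmBE mnm1E /xidx /didx eq_lrshift subn0.
Qed.

End OneRep.

End WeylRepresentations.

Section Intertwiners.
Variables (K : comNzRingType) (n : nat) (E F : lmodType K).
Variables (X D : 'I_n -> E -> E) (X' D' : 'I_n -> F -> F) (phi : E -> F).

Lemma fop_morph (T : 'I_n -> E -> E) (T' : 'I_n -> F -> F) e s u :
  (forall i v, phi (T i v) = T' i (phi v)) -> phi (fop T e s u) = fop T' e s (phi u).
Proof.
move=> pT; elim: s => //= j s <-.
by elim: (e j) => //= k <-.
Qed.

Hypotheses (lphi : linear phi) (phiX : forall i v, phi (X i v) = X' i (phi v))
  (phiD : forall i v, phi (D i v) = D' i (phi v)).

Lemma mop_morph m u : phi (mop X D m u) = mop X' D' m (phi u).
Proof. by rewrite /mop (fop_morph _ _ _ phiX) (fop_morph _ _ _ phiD). Qed.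

Lemma ev_morph P u : phi (ev X D P u) = ev X' D' P (phi u).
Proof.
by rewrite /ev /lext (lin_sum _ _ _ _ lphi); apply: eq_bigr => m _; rewrite mop_morph.
Qed.

End Intertwiners.

Lemma mderivXM (K : comNzRingType) k (i j : 'I_k) (p : {mpoly K[k]}) :
  ('X_j * p)^`M(i) = (i == j)%:R *: p + 'X_j * p^`M(i).
Proof.
rewrite mderivM mderivX mnm1E eq_sym; congr (_ + _).
rewrite -scalerAl; have [->|_] := eqVneq i j; last by rewrite !scale0r.
by rewrite (_ : U_(j) - U_(j) = 0)%MM ?mpolyX0 ?scale1r ?mul1r //; apply/mnmP => a; rewrite mnmBE subnn mnm0E.
Qed.

(** * The Weyl product on normally ordered expressions *)

Section WeylProduct.
Variables (K : comNzRingType) (n : nat).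
Local Notation W := {mpoly K[n + n]}.
Implicit Types (P Q S : W).

Definition lx (i : 'I_n) P : W := 'X_(xidx i) * P.
(** Normal ordering of d_i P costs the commutator [d_i, P], which is the formal derivative in x_i;
    in [rx], that of P x_i costs [P, x_i], the formal derivative in d_i. *)
Definition ld (i : 'I_n) P : W := 'X_(didx i) * P + P^`M(xidx i).
Definition wm P Q : W := ev lx ld P Q.
Definition rx (i : 'I_n) P : W := 'X_(xidx i) * P + P^`M(didx i).
Definition rd (i : 'I_n) P : W := 'X_(didx i) * P.

Lemma lx_linear i : linear (lx i).
Proof. by move=> a A B; rewrite /lx mulrDr scalerAr. Qed.

Lemma ld_linear i : linear (ld i).
Proof. by move=> a A B; rewrite /ld mulrDr -scalerAr mderivD mderivZ scalerDr addrACA. Qed.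

Lemma ratxlinear i : linear (rx i).
Proof. by move=> a A B; rewrite /rx mulrDr -scalerAr mderivD mderivZ scalerDr addrACA. Qed.

Lemma rd_linear i : linear (rd i).
Proof. by move=> a A B; rewrite /rd mulrDr scalerAr. Qed.

Lemma weyl_rep_wm : weyl_rep lx ld.
Proof.
split.
- exact: lx_linear.
- exact: ld_linear.
- by move=> i j u; rewrite /lx mulrCA.
- move=> i j u; rewrite /ld !mderivD !mderivXM !eq_lrshift.
  rewrite (mderiv_comm (xidx j)) !scale0r !add0r.
  by rewrite !mulrDr mulrCA -!addrA; congr (_ + _); rewrite addrCA.
move=> i j u; rewrite /ld /lx mderivXM eq_lshift.
by rewrite mulrDr mulrCA -!addrA; congr (_ + _); rewrite addrC.
Qed.

Section Evaluation.
Variables (E : lmodType K) (X D : 'I_n -> E -> E).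
Hypothesis rep : weyl_rep X D.

Lemma ev_lx i P u : ev X D (lx i P) u = X i (ev X D P u).
Proof.
have l1 : linear (fun P => ev X D (lx i P) u).
  by move=> a A B; rewrite lx_linear ev_linear_l.
have l2 : linear (fun P => X i (ev X D P u)).
  by move=> a A B; rewrite ev_linear_l (rep_linX rep).
apply: (eq_lin_mpoly l1 l2) => m.
by rewrite /lx -mpolyXD addmC !evX mop_addx.
Qed.

Lemma ev_ld i P u : ev X D (ld i P) u = D i (ev X D P u).
Proof.
have l1 : linear (fun P => ev X D (ld i P) u).
  by move=> a A B; rewrite ld_linear ev_linear_l.
have l2 : linear (fun P => D i (ev X D P u)).
  by move=> a A B; rewrite ev_linear_l (rep_linD rep).
apply: (eq_lin_mpoly l1 l2) => m.
rewrite /ld -mpolyXD addmC mderivX (linD (ev_linear_l _ _ _)).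
by rewrite (linZ (ev_linear_l _ _ _)) !evX D_mop.
Qed.

(** The map Q |-> [ev X D Q u] intertwines the left multiplications on the algebra with the
    operators on E. With E the algebra itself this is associativity. *)
Lemma ev_wm P Q u : ev X D (wm P Q) u = ev X D P (ev X D Q u).
Proof.
apply: (@ev_morph K n _ _ lx ld X D (fun Q => ev X D Q u)).
- exact: ev_linear_l.
- by move=> i v; rewrite ev_lx.
- by move=> i v; rewrite ev_ld.
Qed.

End Evaluation.

Lemma wmA P Q S : wm (wm P Q) S = wm P (wm Q S).
Proof. exact: (ev_wm weyl_rep_wm). Qed.

Lemma wm1l P : wm 1 P = P.
Proof. exact: ev1. Qed.

Lemma wm_linear_l Q : linear (fun P => wm P Q).
Proof. exact: ev_linear_l. Qed.

Lemma wm_linear_r P : linear (wm P).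
Proof. exact: (ev_linear_r weyl_rep_wm). Qed.

Lemma fop_lx e s P : uniq s ->
  fop lx e s P = 'X_[\sum_(i <- s) U_(xidx i) *+ e i] * P.
Proof.
elim: s => [|j s IH]; first by rewrite big_nil mpolyX0 mul1r.
move=> /= /andP [_ us]; rewrite -/(fop lx e s P) IH // big_cons mpolyXD -mulrA.
elim: (e j) => [|k IHk] /=; first by rewrite mulm0n mpolyX0 mul1r.
by rewrite IHk /lx mulmS mpolyXD -mulrA.
Qed.

Lemma fop_ld1 e s : uniq s ->
  fop ld e s 1 = 'X_[\sum_(i <- s) U_(didx i) *+ e i].
Proof.
elim: s => [|j s IH]; first by rewrite big_nil mpolyX0.
move=> /= /andP [_ us]; rewrite -/(fop ld e s 1) IH // big_cons mpolyXD.
elim: (e j) => [|k IHk] /=; first by rewrite mulm0n mpolyX0 mul1r.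
rewrite IHk /ld mulmS mpolyXD -mulrA.
rewrite -!mpolyXD mderivX mnmDE mulmnE mnm1E eq_rlshift mul0n add0n.
rewrite mnm_sumE [X in X%:R]big1 ?scale0r ?addr0 // => i _.
by rewrite mulmnE mnm1E eq_rlshift mul0n.
Qed.

Lemma mop_wm1 m : mop lx ld m 1 = 'X_[m].
Proof.
rewrite /mop fop_ld1 ?enum_uniq // fop_lx ?enum_uniq // -mpolyXD; congr 'X_[_].
apply/mnmP => a; rewrite mnmDE !mnm_sumE.
have [i ->|i ->] := split_ordP a.
  rewrite [X in (_ + X)%N]big1 ?addn0; last first.
    by move=> j _; rewrite mulmnE mnm1E eq_rlshift.
  rewrite big_enum /= (bigD1 i) //= big1 ?addn0.
    by rewrite mulmnE mnm1E eqxx mul1n.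
  by move=> j ji; rewrite mulmnE mnm1E eq_lshift (negPf ji) mul0n.
rewrite big1 ?add0n; last first.
  by move=> j _; rewrite mulmnE mnm1E eq_lrshift.
rewrite big_enum /= (bigD1 i) //= big1 ?addn0.
  by rewrite mulmnE mnm1E eqxx mul1n.
by move=> j ji; rewrite mulmnE mnm1E eq_rshift (negPf ji) mul0n.
Qed.

Lemma wm1r P : wm P 1 = P.
Proof.
apply: (eq_lin_mpoly (wm_linear_l _) (f := fun P => wm P 1) (h := id)) => // m.
by rewrite /wm evX mop_wm1.
Qed.

(* An endomorphism of the left module D_n is right multiplication by the image of 1. *)
Lemma wm_endo (phi : W -> W) P : linear phi ->
  (forall i v, phi (lx i v) = lx i (phi v)) ->
  (forall i v, phi (ld i v) = ld i (phi v)) -> phi P = wm P (phi 1).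
Proof. by move=> lp px pd; rewrite -[P in LHS]wm1r (ev_morph lp px pd). Qed.

(** [rx i] commutes with all left multiplications by generators, so [wm_endo] identifies it as right
    multiplication by its value at 1. *)
Lemma wm_rx i P : wm P 'X_(xidx i) = rx i P.
Proof.
rewrite (wm_endo _ (ratxlinear i)) ?/rx ?mulr1.
- by rewrite -[X in X^`M(_)]mpolyC1 mderivC addr0.
- move=> j v; rewrite /rx /lx mderivXM eq_rlshift scale0r add0r.
  by rewrite mulrDr mulrCA.
move=> j v; rewrite /rx /ld mulrDr !mderivD !mderivXM eq_lshift eq_rshift.
rewrite (mderiv_comm (xidx j)) mulrDr mulrCA eq_sym -!addrA; congr (_ + _).
by rewrite !addrA; congr (_ + _); rewrite addrC [X in _ + X]addrC addrA.
Qed.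

Lemma wm_rd i P : wm P 'X_(didx i) = rd i P.
Proof.
rewrite (wm_endo _ (rd_linear i)) ?/rd ?mulr1 //.
- by move=> j v; rewrite /rd /lx mulrCA.
by move=> j v; rewrite /rd /ld mderivXM eq_lrshift scale0r add0r mulrDr mulrCA.
Qed.

Lemma wm_lx i P : wm 'X_(xidx i) P = lx i P.
Proof.
by rewrite -[in LHS](mulr1 'X_(xidx i)) -/(lx i 1) /wm (ev_lx weyl_rep_wm) -/(wm _ _) wm1l.
Qed.

Lemma wm_ld i P : wm 'X_(didx i) P = ld i P.
Proof.
have -> : 'X_(didx i) = ld i 1.
  by rewrite /ld mulr1 -[X in X^`M(_)]mpolyC1 mderivC addr0.
by rewrite /wm (ev_ld weyl_rep_wm) -/(wm _ _) wm1l.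
Qed.

End WeylProduct.

Lemma theta_X (K : comNzRingType) k (i : 'I_k) (m : 'X_{1..k}) :
  'X_i * ('X_[m])^`M(i) = (m i)%:R *: 'X_[m] :> {mpoly K[k]}.
Proof.
rewrite mderivX -scalerAr.
have [->|mi] := eqVneq (m i) 0%N; first by rewrite !scale0r.
congr (_ *: _); rewrite -mpolyXD; congr 'X_[_]; apply/mnmP => a.
rewrite mnmDE mnmBE mnm1E; have [<-|_] := eqVneq i a; last by rewrite subn0.
by rewrite addnC subnK // lt0n.
Qed.

Lemma mcoeff_theta (K : comNzRingType) k (i : 'I_k) (A : {mpoly K[k]}) m :
  ('X_i * A^`M(i))@_m = (m i)%:R * A@_m.
Proof.
apply: (eq_lin_mpoly (E := K^o) (f := fun A => ('X_i * A^`M(i))@_m)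
  (h := fun A => (m i)%:R * A@_m)) => [a P Q|a P Q|m'] /=.
- by rewrite mderivD mderivZ mulrDr -scalerAr mcoeffD mcoeffZ.
- by rewrite mcoeffD mcoeffZ mulrDr mulrCA.
rewrite theta_X mcoeffZ mcoeffX; have [->//|_] := eqVneq m' m.
by rewrite !mulr0.
Qed.

(** * Weights, leading components and initial forms *)

Section Weights.
Variables (R : realDomainType) (K : comNzRingType) (k : nat) (v : 'I_k -> R).
Implicit Types (A B : {mpoly K[k]}) (S : pred R) (m : 'X_{1..k}).

Definition vw m : R := \sum_(i < k) v i *+ m i.

(** An arbitrary set S of allowed weights treats the bounds <= e, < e and homogeneity = e by the
    same lemmas. *)
Definition wsupp S A : Prop := forall m, m \in msupp A -> S (vw m).

Definition wle e A := wsupp (fun x => x <= e) A.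
Definition wlt e A := wsupp (fun x => x < e) A.
Definition whom e A := wsupp (fun x => x == e) A.

Lemma vwD m1 m2 : vw (m1 + m2) = vw m1 + vw m2.
Proof. by rewrite /vw -big_split /=; apply: eq_bigr => i _; rewrite mnmDE mulrnDr. Qed.

Lemma vwU i : vw U_(i) = v i.
Proof.
rewrite /vw (bigD1 i) //= big1 ?addr0 ?mnm1E ?eqxx ?mulr1n // => j ji.
by rewrite mnm1E eq_sym (negPf ji).
Qed.

Lemma wsupp0 S : wsupp S 0.
Proof. by move=> m; rewrite msupp0. Qed.

Lemma wsuppD S A B : wsupp S A -> wsupp S B -> wsupp S (A + B).
Proof. by move=> hA hB m /msuppD_le; rewrite mem_cat => /orP [/hA|/hB]. Qed.

Lemma wsuppZ S c A : wsupp S A -> wsupp S (c *: A).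
Proof. by move=> hA m /msuppZ_le /hA. Qed.

Lemma wsuppN S A : wsupp S A -> wsupp S (- A).
Proof. by move=> hA; rewrite -scaleN1r; apply: wsuppZ. Qed.

Lemma wsuppB S A B : wsupp S A -> wsupp S B -> wsupp S (A - B).
Proof. by move=> hA hB; apply: wsuppD => //; apply: wsuppN. Qed.

Lemma wsupp_sum S (I : eqType) (s : seq I) (P : pred I) (F : I -> {mpoly K[k]}) :
  (forall i, i \in s -> P i -> wsupp S (F i)) -> wsupp S (\sum_(i <- s | P i) F i).
Proof.
move=> h; rewrite big_seq_cond; apply: (big_ind (wsupp S)).
- exact: wsupp0.
- exact: wsuppD.
- by move=> i /andP [is_ Pi]; apply: h.
Qed.

Lemma wsuppX S m : S (vw m) -> wsupp S 'X_[m].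
Proof. by move=> h m'; rewrite msuppX inE => /eqP ->. Qed.

Lemma wsupp_sub S S' A : (forall a, S a -> S' a) -> wsupp S A -> wsupp S' A.
Proof. by move=> sub h m /h /sub. Qed.

Lemma wsuppM S S' S'' A B : wsupp S A -> wsupp S' B ->
  (forall a b, S a -> S' b -> S'' (a + b)) -> wsupp S'' (A * B).
Proof.
move=> hA hB h m /msuppM_le /allpairsP [[m1 m2] /= [h1 h2 ->]].
by rewrite vwD; apply: h; [apply: hA | apply: hB].
Qed.

Lemma wsupp_deriv S S' i A : wsupp S A -> (forall a, S a -> S' (a - v i)) ->
  wsupp S' A^`M(i).
Proof.
move=> hA h m; rewrite mcoeff_msupp mcoeff_mderiv => ne.
have : (m + U_(i))%MM \in msupp A.
  by rewrite mcoeff_msupp; apply: contra ne => /eqP ->; rewrite mul0rn.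
by move=> /hA /h; rewrite vwD vwU addrK.
Qed.

Lemma whom_wlt0 e A : whom e A -> wlt e A -> A = 0.
Proof.
move=> hh hl; apply/eqP; rewrite -msupp_eq0; case E: (msupp A) => [//|m s].
have mA : m \in msupp A by rewrite E mem_head.
by move: (hl m mA); rewrite (eqP (hh m mA)) ltxx.
Qed.

Lemma wlt_wle e A : wlt e A -> wle e A.
Proof. by apply: wsupp_sub => a /ltW. Qed.

Lemma whom_wle e A : whom e A -> wle e A.
Proof. by apply: wsupp_sub => a /eqP ->. Qed.

(** A' is the component of weight e of an A with nothing above e. It may be 0, which makes the
    relation stable under sums, products and derivatives, where top terms can cancel. *)
Definition lead e A A' := whom e A' /\ wlt e (A - A').

Lemma lead_wle e A A' : lead e A A' -> wle e A.
Proof.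
by move=> [h1 h2]; rewrite -(subrK A' A); apply: wsuppD; [apply: wlt_wle|apply: whom_wle].
Qed.

Lemma leadD e A A' B B' : lead e A A' -> lead e B B' -> lead e (A + B) (A' + B').
Proof.
move=> [h1 h2] [h3 h4]; split; first exact: wsuppD.
by rewrite opprD addrACA; apply: wsuppD.
Qed.

Lemma leadZ e c A A' : lead e A A' -> lead e (c *: A) (c *: A').
Proof. by move=> [h1 h2]; split; [|rewrite -scalerBr]; apply: wsuppZ. Qed.

Lemma leadB e A A' B B' : lead e A A' -> lead e B B' -> lead e (A - B) (A' - B').
Proof.
by move=> h1 h2; apply: leadD => //; rewrite -!scaleN1r; apply: leadZ.
Qed.

Lemma lead_wlt e A : wlt e A -> lead e A 0.
Proof. by move=> h; split; [apply: wsupp0 | rewrite subr0]. Qed.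

Lemma lead_whom e A : whom e A -> lead e A A.
Proof. by move=> h; split; rewrite ?subrr //; apply: wsupp0. Qed.

Lemma leadM e e' A A' B B' : lead e A A' -> lead e' B B' ->
  lead (e + e') (A * B) (A' * B').
Proof.
move=> LA [h3 h4]; have [h1 h2] := LA; split.
  by apply: wsuppM h1 h3 _ => a b /eqP -> /eqP ->.
have -> : A * B - A' * B' = A * (B - B') + (A - A') * B'.
  by rewrite mulrBr mulrBl addrA subrK.
apply: wsuppD.
  by apply: wsuppM (lead_wle LA) h4 _ => a b ha hb; apply: ler_ltD.
by apply: wsuppM h2 h3 _ => a b ha /eqP ->; rewrite ltrD2r.
Qed.

Lemma lead1 : lead 0 1 1.
Proof.
apply: lead_whom; rewrite -mpolyX0; apply: wsuppX.
by rewrite /vw big1 // => i _; rewrite mnm0E.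
Qed.

Lemma leadXn e A A' j : lead e A A' -> lead (e *+ j) (A ^+ j) (A' ^+ j).
Proof.
move=> h; elim: j => [|j IH]; first by rewrite !expr0; apply: lead1.
by rewrite !exprS mulrS; apply: leadM.
Qed.

Lemma lead_deriv e i A A' : lead e A A' -> lead (e - v i) A^`M(i) A'^`M(i).
Proof.
move=> [h1 h2]; split.
  by apply: wsupp_deriv h1 _ => a /eqP ->.
by rewrite -mderivB; apply: wsupp_deriv h2 _ => a; rewrite ltrD2r.
Qed.

Definition top_mon A m := all (fun m' => vw m' <= vw m) (msupp A).

Definition ini A : {mpoly K[k]} :=
  \sum_(m <- msupp A | top_mon A m) A@_m *: 'X_[m].

Lemma mcoeff_ini A m : (ini A)@_m = if top_mon A m then A@_m else 0.
Proof.
rewrite /ini raddf_sum /=; under eq_bigr do rewrite mcoeffZ mcoeffX.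
have [mA|mA] := boolP (m \in msupp A); last first.
  rewrite memN_msupp_eq0 // if_same big_seq_cond big1 // => m' /andP [h _].
  by case: eqP => [e|_]; rewrite ?mulr0 //; rewrite -e h in mA.
rewrite big_mkcond (bigD1_seq m) ?msupp_uniq //= eqxx mulr1 big1 ?addr0 //.
by move=> m' /negPf ->; rewrite mulr0 if_same.
Qed.

Lemma max_vw (s : seq 'X_{1..k}) : s != [::] ->
  exists2 m, m \in s & forall m', m' \in s -> vw m' <= vw m.
Proof.
elim: s => // m s IH _; have [->|/IH [m' m's h]] := eqVneq s [::].
  by exists m; rewrite ?mem_head // => m'; rewrite inE => /eqP ->.
have [le|le] := leP (vw m) (vw m').
  by exists m'; rewrite ?inE ?m's ?orbT // => a; rewrite inE => /orP [/eqP ->|/h].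
exists m; rewrite ?mem_head // => a; rewrite inE => /orP [/eqP ->//|/h].
by move=> /le_trans; apply; apply: ltW.
Qed.

Lemma lead_ini A : A != 0 -> exists2 e, lead e A (ini A) & ini A != 0.
Proof.
rewrite -msupp_eq0 => /max_vw [m mA hm]; exists (vw m).
  have top a : a \in msupp A -> top_mon A a = (vw a == vw m).
    move=> aA; apply/allP/eqP => [h|-> //].
    by apply/eqP; rewrite eq_le hm // h.
  split => a; rewrite mcoeff_msupp ?mcoeffB mcoeff_ini; have [aA|aA] := boolP (a \in msupp A).
  - by rewrite top //; case: ifP => //; rewrite eqxx.
  - by rewrite memN_msupp_eq0 // if_same eqxx.
  - rewrite top //; case: ifP => [_|ne]; first by rewrite subrr eqxx.
    by rewrite lt_neqAle ne hm.
  - by rewrite memN_msupp_eq0 // if_same subrr eqxx.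
apply: contraTneq mA => ini0; rewrite mcoeff_msupp.
move: (mcoeff_ini A m); rewrite ini0 mcoeff0 ifT => [<-|]; first by rewrite eqxx.
by apply/allP.
Qed.

(** If the two leading weights differed, the component at the higher one would vanish; at equal
    weights the difference is both homogeneous and of lower weight, hence 0. *)
Lemma ini_lead e A A' : A' != 0 -> lead e A A' -> ini A = A'.
Proof.
move=> nz L; have [h1 h2] := L.
have nzA : A != 0.
  apply: contra nz => /eqP A0; apply/eqP; apply: (@whom_wlt0 e) => //.
  by rewrite -(opprK A'); apply: wsuppN; rewrite -[- A']add0r -A0.
have [e' L' nz'] := lead_ini nzA.
have [lt|lt|ee] := ltgtP e e'.
- case/negP: nz'; apply/eqP; apply: (@whom_wlt0 e'); first by case: L'.
  rewrite -[ini A](subKr A); apply: wsuppB; last by case: L'.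
  by apply: wsupp_sub (lead_wle L) => a /le_lt_trans; apply.
- case/negP: nz; apply/eqP; apply: (@whom_wlt0 e) => //.
  rewrite -[A'](subKr A); apply: wsuppB => //.
  by apply: wsupp_sub (lead_wle L') => a /le_lt_trans; apply.
rewrite -{}ee in L'; apply/eqP; rewrite -subr_eq0; apply/eqP.
apply: (@whom_wlt0 e); first by apply: wsuppB => //; case: L'.
have -> : ini A - A' = (A - A') - (A - ini A).
  by rewrite opprB [RHS]addrC -addrA addKr.
by apply: wsuppB => //; case: L'.
Qed.


Lemma euler (iota : {rmorphism R -> K}) e A : whom e A ->
  \sum_(i < k) iota (v i) *: ('X_i * A^`M(i)) = iota e *: A.
Proof.
move=> hA; pose th A := \sum_(i < k) iota (v i) *: ('X_i * A^`M(i)).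
have lth : linear th.
  move=> a P Q; rewrite /th scaler_sumr -big_split /=; apply: eq_bigr => i _.
  rewrite mderivD mderivZ mulrDr scalerDr -scalerAr !scalerA; congr (_ *: _ + _).
  by rewrite mulrC.
rewrite -/(th A) {1}[A]mpolyE (lin_sum _ _ _ _ lth) [in RHS](mpolyE A) scaler_sumr.
apply: eq_big_seq => m /hA /eqP <-; rewrite scalerA mulrC -scalerA; congr (_ *: _).
rewrite /th /vw rmorph_sum /= scaler_suml; apply: eq_bigr => i _.
by rewrite theta_X scalerA rmorphMn -[in RHS]mulr_natr.
Qed.

End Weights.

(** * Compatibility of Weyl operators with weight filtrations *)

Section FilteredAction.
Variables (R : realDomainType) (K : comNzRingType) (n : nat).
Variable (v : 'I_(n + n) -> R).

(** Relating two elements at a given weight lets one induction serve both filtrations and the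
    comparison of a fraction with its leading form. *)
Lemma fop_shift (E F : Type) (T : 'I_n -> E -> E) (T' : 'I_n -> F -> F) (t : 'I_n -> R)
    (G : R -> E -> F -> Prop) a s d u u' :
  (forall i d u u', G d u u' -> G (d + t i) (T i u) (T' i u')) ->
  G d u u' -> G (d + \sum_(i <- s) t i *+ a i) (fop T a s u) (fop T' a s u').
Proof.
move=> GT Gu; elim: s => [|j s IH]; first by rewrite big_nil addr0.
rewrite big_cons addrCA addrC /=; elim: (a j) => [|c IHc] /=.
  by rewrite mulr0n addr0.
by rewrite mulrSr addrA; apply: GT.
Qed.

Lemma mop_shift (E F : Type) (X D : 'I_n -> E -> E) (X' D' : 'I_n -> F -> F)
    (G : R -> E -> F -> Prop) m d u u' :
  (forall i d u u', G d u u' -> G (d + v (xidx i)) (X i u) (X' i u')) ->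
  (forall i d u u', G d u u' -> G (d + v (didx i)) (D i u) (D' i u')) ->
  G d u u' -> G (d + vw v m) (mop X D m u) (mop X' D' m u').
Proof.
move=> GX GD Gu.
have -> : d + vw v m = (d + \sum_(i <- enum 'I_n) v (didx i) *+ dexp m i)
                         + \sum_(i <- enum 'I_n) v (xidx i) *+ xexp m i.
  by rewrite !big_enum /= -addrA; congr (_ + _); rewrite [RHS]addrC /vw big_split_ord.
rewrite /mop; apply: (fop_shift (t := fun i => v (xidx i)) (G := G)) => //.
exact: (fop_shift (t := fun i => v (didx i)) (G := G)).
Qed.

Lemma ev_wle (E : lmodType K) (X D : 'I_n -> E -> E) (G : R -> E -> Prop) P a d u :
  (forall d, G d 0) -> (forall d u u', G d u -> G d u' -> G d (u + u')) ->
  (forall d c u, G d u -> G d (c *: u)) ->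
  (forall d d' u, d <= d' -> G d u -> G d' u) ->
  (forall i d u, G d u -> G (d + v (xidx i)) (X i u)) ->
  (forall i d u, G d u -> G (d + v (didx i)) (D i u)) ->
  wle v a P -> G d u -> G (d + a) (ev X D P u).
Proof.
move=> G0 GA GZ Gm GX GD hP Gu; rewrite /ev /lext big_seq_cond.
apply: (big_ind (G (d + a))) => [||m /andP [mP _]]; [exact: G0|exact: GA|].
apply: GZ; apply: (Gm (d + vw v m)); first by rewrite lerD2l; apply: hP.
have GX' i c w (w' : E) : G c w -> G (c + v (xidx i)) (X i w) by move=> ?; apply: GX.
have GD' i c w (w' : E) : G c w -> G (c + v (didx i)) (D i w) by move=> ?; apply: GD.
exact: (@mop_shift E E X D X D (fun d u _ => G d u) m d u u GX' GD').
Qed.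

Hypothesis v_ge0 : forall i, 0 <= v (xidx i) + v (didx i).

(** The correction term of [ld i] is a derivative, of weight shift - v(x_i); by [v_ge0] this is at
    most v(d_i), so reordering never raises the weight. *)
Lemma wle_wm a b (P Q : {mpoly K[n + n]}) :
  wle v a P -> wle v b Q -> wle v (a + b) (wm P Q).
Proof.
move=> hP hQ; have hX a' : whom v (v a') ('X_a' : {mpoly K[n + n]}).
  by apply: wsuppX; rewrite vwU.
rewrite addrC; apply: (ev_wle (G := wle v)) hP hQ => //.
- by move=> d; apply: wsupp0.
- by move=> *; apply: wsuppD.
- by move=> *; apply: wsuppZ.
- by move=> d d' u h; apply: wsupp_sub => x /le_trans; apply.
- move=> i d u h; rewrite addrC; apply: wsuppM (hX _) h _ => x y /eqP -> hy.
  by rewrite lerD2l.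
move=> i d u h; apply: wsuppD.
  rewrite addrC; apply: wsuppM (hX _) h _ => x y /eqP -> hy.
  by rewrite lerD2l.
apply: wsupp_deriv h _ => x hx; apply: lerD => //.
by rewrite -subr_ge0 opprK addrC.
Qed.

End FilteredAction.

Local Notation "x %:F" := (@FracField.tofrac _ x) : ring_scope.

(** * The actions on polynomials and on rational functions *)

Lemma mderiv1 (K : nzRingType) n i : (1 : {mpoly K[n]})^`M(i) = 0.
Proof. by rewrite -mpolyC1 mderivC. Qed.

Section PolyRepresentation.
Variables (K : comNzRingType) (n : nat).

Definition px (i : 'I_n) (A : {mpoly K[n]}) : {mpoly K[n]} := 'X_i * A.
Definition pd (i : 'I_n) (A : {mpoly K[n]}) : {mpoly K[n]} := A^`M(i).

Lemma weyl_rep_poly : weyl_rep px pd.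
Proof.
split.
- by move=> i a A B; rewrite /px mulrDr scalerAr.
- by move=> i a A B; rewrite /pd mderivD mderivZ.
- by move=> i j u; rewrite /px mulrCA.
- by move=> i j u; rewrite /pd mderiv_comm.
by move=> i j u; rewrite /pd /px mderivXM addrC.
Qed.

End PolyRepresentation.

(** A named copy of the fraction field, to carry the scalar action of K next to the field
    structure. *)
Definition ratmod (K : fieldType) (n : nat) := {fraction {mpoly K[n]}}.

(** The hypotheses are a/b = N/d in cross-multiplied form and the derivative of that identity. *)
Lemma quotient_rule_wd (R : comNzRingType) (a b N d a' b' N' d' : R) :
  a * d = N * b -> a' * d + a * d' = N' * b + N * b' ->
  (N' * d - N * d') * (b * b) = (a' * b - a * b') * (d * d).
Proof.
move=> e e'; have eN : N' * b = a' * d + a * d' - N * b' by rewrite e' addrK.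
have -> : (N' * d - N * d') * (b * b) = (N' * b) * (b * d) - (N * b) * (b * d') by ring.
rewrite eN mulrBl; have -> : N * b' * (b * d) = (N * b) * (b' * d) by ring.
by rewrite -e; ring.
Qed.

Lemma quotient_ruleM (F : fieldType) (a b c d a' b' c' d' : F) : b != 0 -> d != 0 ->
  ((a' * c + a * c') * (b * d) - a * c * (b' * d + b * d')) / (b * d * (b * d)) =
  (a' * b - a * b') / (b * b) * (c / d) + a / b * ((c' * d - c * d') / (d * d)).
Proof. by move=> b0 d0; field; rewrite b0 d0. Qed.

Lemma quotient_ruleD (F : fieldType) (a b c d a' b' c' d' : F) : b != 0 -> d != 0 ->
  ((a' * d + a * d' + (c' * b + c * b')) * (b * d) -
   (a * d + c * b) * (b' * d + b * d')) / (b * d * (b * d)) =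
  (a' * b - a * b') / (b * b) + (c' * d - c * d') / (d * d).
Proof. by move=> b0 d0; field; rewrite b0 d0. Qed.

Lemma quotient_rule_comm (A : comNzRingType) (a b ai bi aj bj aij bij : A) :
  (aij * b + aj * bi - (ai * bj + a * bij)) * (b * b) -
    (aj * b - a * bj) * (bi * b + b * bi) =
  (aij * b + ai * bj - (aj * bi + a * bij)) * (b * b) -
    (ai * b - a * bi) * (bj * b + b * bj).
Proof. by ring. Qed.

Section RationalFunctions.
Variables (K : fieldType) (n : nat).
Local Notation E := (ratmod K n).
Local Notation A := {mpoly K[n]}.

HB.instance Definition _ := GRing.Field.on E.

Definition rscale (c : K) (u : E) : E := (c%:MP : A)%:F * u.

Lemma rscaleA a b u : rscale a (rscale b u) = rscale (a * b) u.
Proof. by rewrite /rscale mpolyCM tofracM mulrA. Qed.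
Lemma rscale1 : left_id 1 rscale.
Proof. by move=> u; rewrite /rscale mpolyC1 tofrac1 mul1r. Qed.
Lemma rscaleDr : right_distributive rscale +%R.
Proof. by move=> a u v; rewrite /rscale mulrDr. Qed.
Lemma rscaleDl u : {morph rscale^~ u : a b / a + b}.
Proof. by move=> a b; rewrite /rscale mpolyCD tofracD mulrDl. Qed.
HB.instance Definition _ :=
  GRing.Zmodule_isLmodule.Build K E rscaleA rscale1 rscaleDr rscaleDl.

Lemma scale_ratE (c : K) (u : E) : c *: u = (c%:MP : A)%:F * u.
Proof. by []. Qed.

Lemma tofrac_linear : linear (fun p : A => p%:F : E).
Proof. by move=> c p q; rewrite tofracD scale_ratE -tofracM mul_mpolyC. Qed.

Lemma frac_repr (u : {fraction A}) : u * (\d_(repr u))%:F = (\n_(repr u))%:F.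
Proof.
rewrite -[X in X * _]reprK; unlock FracField.tofrac; rewrite -[LHS]FracField.pi_mul.
apply/eqmodP; rewrite /= FracField.equivfE /FracField.mulf.
by rewrite !numden_Ratio ?(oner_eq0, mulf_neq0, denom_ratioP, mulr1) //= mulrC.
Qed.

Lemma frac_ex (u : E) : exists a b : A, b != 0 /\ u = a%:F / b%:F.
Proof.
exists \n_(repr u), \d_(repr u); split; first exact: denom_ratioP.
by rewrite -frac_repr mulfK // tofrac_eq0 denom_ratioP.
Qed.

Definition dfr (i : 'I_n) (u : E) : E :=
  let r := repr u in
  ((\n_r)^`M(i) * \d_r - \n_r * (\d_r)^`M(i))%:F / (\d_r * \d_r)%:F.

Lemma eq_frac (a b c d : A) : b != 0 -> d != 0 ->
  (a%:F / b%:F == c%:F / d%:F :> E) = (a * d == c * b).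
Proof.
by move=> b0 d0; rewrite eqr_div ?tofrac_eq0 // -!tofracM tofrac_eq.
Qed.

(** [dfr] is defined through a chosen representative; since the quotient rule is independent of that
    choice, any expression a/b may be differentiated. *)
Lemma dfr_frac i (a b : A) : b != 0 ->
  dfr i (a%:F / b%:F) = (a^`M(i) * b - a * b^`M(i))%:F / (b * b)%:F.
Proof.
move=> b0; set u := _ / _; pose N := \n_(repr u); pose d := \d_(repr u).
have d0 : d != 0 by exact: denom_ratioP.
have e : a * d = N * b.
  apply/eqP; rewrite -eq_frac //; apply/eqP; rewrite -/u.
  by apply: (canRL (mulfK _)); [rewrite tofrac_eq0 | apply: frac_repr].
apply/eqP; rewrite eq_frac ?mulf_neq0 //; apply/eqP.
by apply: quotient_rule_wd => //; rewrite -!mderivM e.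
Qed.

Lemma dfr_tofrac i (a : A) : dfr i (a%:F) = (a^`M(i))%:F.
Proof.
have := dfr_frac i a (oner_neq0 _); rewrite tofrac1 divr1 => ->.
by rewrite !mulr1 tofrac1 divr1 mderiv1 mulr0 subr0.
Qed.

Lemma dfrM i (u w : E) : dfr i (u * w) = dfr i u * w + u * dfr i w.
Proof.
have [a [b [b0 ->]]] := frac_ex u; have [c [d [d0 ->]]] := frac_ex w.
rewrite mulf_div -!tofracM !dfr_frac ?mulf_neq0 // !mderivM.
rewrite !(tofracB, tofracD, tofracM).
by apply: quotient_ruleM; rewrite tofrac_eq0.
Qed.

Lemma dfr_linear i : linear (dfr i).
Proof.
have dfrD u w : dfr i (u + w) = dfr i u + dfr i w.
  have [a [b [b0 ->]]] := frac_ex u; have [c [d [d0 ->]]] := frac_ex w.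
  rewrite addf_div ?tofrac_eq0 // -!tofracM -tofracD !dfr_frac ?mulf_neq0 //.
  rewrite !mderivD !mderivM !(tofracB, tofracD, tofracM).
  by apply: quotient_ruleD; rewrite tofrac_eq0.
by move=> c u w; rewrite dfrD scale_ratE dfrM dfr_tofrac mderivC tofrac0 mul0r add0r.
Qed.

Lemma dfr_comm i j (u : E) : dfr i (dfr j u) = dfr j (dfr i u).
Proof.
have [a [b [b0 ->]]] := frac_ex u.
rewrite !dfr_frac ?mulf_neq0 // !mderivB !mderivM (mderiv_comm i j a) (mderiv_comm i j b).
by congr (_%:F / _); apply: quotient_rule_comm.
Qed.

Lemma dfr1 i : dfr i 1 = 0.
Proof. by rewrite -tofrac1 dfr_tofrac mderiv1 tofrac0. Qed.

Definition ratx (i : 'I_n) (u : E) : E := ('X_i : A)%:F * u.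

Lemma weyl_rep_ratmod : weyl_rep ratx dfr.
Proof.
split.
- by move=> i c u w; rewrite /ratx mulrDr !scale_ratE mulrCA.
- exact: dfr_linear.
- by move=> i j u; rewrite /ratx mulrCA.
- exact: dfr_comm.
move=> i j u; rewrite /ratx dfrM dfr_tofrac addrC; congr (_ + _).
rewrite -['X_j]mulr1 mderivXM mderiv1 mulr0 addr0.
by rewrite scale_ratE; congr (_%:F * _); rewrite -mul_mpolyC mulr1.
Qed.

Lemma ev_tofrac P (a : A) : ev ratx dfr P (a%:F) = (ev (@px K n) (@pd K n) P a)%:F.
Proof.
rewrite -[LHS](ev_morph (phi := fun p : A => p%:F : E) (X := @px K n) (D := @pd K n)) //.
- exact: tofrac_linear.
- by move=> i w; rewrite /px tofracM.
- by move=> i w; rewrite dfr_tofrac.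
Qed.

End RationalFunctions.

(** * The initial ideal and polynomials in s *)

Section InitialIdeal.
Variables (R : realFieldType) (K : numFieldType) (iota : {rmorphism R -> K}).
Variables (n : nat) (w : 'I_n -> R).
Local Notation W := {mpoly K[n + n]}.
Implicit Types (P Q : W) (I : W -> Prop) (p q : {poly K}).

Definition wv (a : 'I_(n + n)) : R :=
  match split a with inl i => - w i | inr i => w i end.

Lemma wv_x i : wv (xidx i) = - w i.
Proof. by rewrite /wv /xidx (unsplitK (inl _ i)). Qed.

Lemma wv_d i : wv (didx i) = w i.
Proof. by rewrite /wv /didx (unsplitK (inr _ i)). Qed.

Lemma wv_ge0 i : 0 <= wv (xidx i) + wv (didx i).
Proof. by rewrite wv_x wv_d addNr. Qed.

Definition iniI I Q : Prop := exists s : seq (W * W),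
  (forall a, a \in s -> exists P, I P /\ P != 0 /\ a.2 = ini wv P) /\
  Q = \sum_(a <- s) wm a.1 a.2.

Lemma iniI0 I : iniI I 0.
Proof. by exists [::]; rewrite big_nil. Qed.

Lemma iniID I P Q : iniI I P -> iniI I Q -> iniI I (P + Q).
Proof.
move=> [s [hs ->]] [s' [hs' ->]]; exists (s ++ s'); rewrite big_cat; split => // a.
by rewrite mem_cat => /orP [/hs|/hs'].
Qed.

Lemma iniI_wm I P Q : iniI I Q -> iniI I (wm P Q).
Proof.
move=> [s [hs ->]]; exists [seq (wm P a.1, a.2) | a <- s]; split.
  by move=> _ /mapP [a /hs h ->].
rewrite (lin_sum1 _ _ _ (wm_linear_r P)) big_map.
by apply: eq_bigr => a _; rewrite wmA.
Qed.

Lemma iniIZ I c Q : iniI I Q -> iniI I (c *: Q).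
Proof.
move=> h; suff -> : c *: Q = wm (c *: 1) Q by apply: iniI_wm.
by rewrite (linZ (wm_linear_l Q)) wm1l.
Qed.

Lemma iniIB I P Q : iniI I P -> iniI I Q -> iniI I (P - Q).
Proof. by move=> hP hQ; apply: iniID => //; rewrite -scaleN1r; apply: iniIZ. Qed.

Lemma iniI_sum I (T : Type) (s : seq T) (p : pred T) (F : T -> W) :
  (forall i, p i -> iniI I (F i)) -> iniI I (\sum_(i <- s | p i) F i).
Proof.
by move=> h; apply: (big_ind (iniI I)) => //; [apply: iniI0|move=> *; apply: iniID].
Qed.

(** A leading component is either 0 or the initial form, so membership needs no separate check that
    it is nonzero. *)
Lemma iniI_lead I e P Q : I P -> lead wv e P Q -> iniI I Q.
Proof.
move=> IP L; have [->|Q0] := eqVneq Q 0; first exact: iniI0.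
have P0 : P != 0.
  apply: contra Q0 => /eqP P0; apply/eqP; apply: (@whom_wlt0 _ _ _ wv e).
    by case: L.
  by rewrite -[Q]opprK; apply: wsuppN; case: L => _; rewrite P0 sub0r.
exists [:: (1, Q)]; rewrite big_seq1 /= wm1l; split => // a; rewrite inE => /eqP ->.
by exists P; split => //; split => //=; rewrite (ini_lead Q0 L).
Qed.

Definition sop : W := \sum_(i < n) iota (w i) *: ('X_(xidx i) * 'X_(didx i)).

Lemma xd_wm i : 'X_(xidx i) * 'X_(didx i) = wm 'X_(xidx i) 'X_(didx i) :> W.
Proof. by rewrite wm_lx. Qed.

Lemma sop_whom : whom wv 0 sop.
Proof.
apply: wsupp_sum => i _ _; apply: wsuppZ; rewrite -mpolyXD; apply: wsuppX.
by rewrite vwD !vwU wv_x wv_d addNr.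
Qed.

(* The commutator of P with s is the Euler operator of the weight (-w, w). *)
Lemma wm_sop kappa P : whom wv kappa P ->
  wm P sop = wm sop P + iota kappa *: P.
Proof.
move=> hP; rewrite -(euler iota hP) big_split_ord /= /sop.
rewrite (lin_sum _ _ _ _ (wm_linear_r P)) (lin_sum _ _ _ _ (wm_linear_l P)).
rewrite -!big_split /=; apply: eq_bigr => i _.
rewrite -/(xidx i) -/(didx i) wv_x wv_d rmorphN scaleNr.
rewrite xd_wm -wmA wm_rd wm_rx wmA wm_ld wm_lx /rd /rx /lx /ld.
rewrite -scalerN -!scalerDr; congr (_ *: _); rewrite !mulrDr mulrCA.
by rewrite -!addrA; congr (_ + _); rewrite addNKr.
Qed.

(** The generators are weight-homogeneous, and for homogeneous P the commutator of P with s is a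
    multiple of P. Hence this left ideal is also stable under right multiplication by s. *)
Lemma iniI_sop I Q : iniI I Q -> iniI I (wm Q sop).
Proof.
move=> [s [hs ->]]; rewrite (lin_sum1 _ _ _ (wm_linear_l sop)).
rewrite big_seq; apply: iniI_sum => a /hs [P [IP [P0 eP]]].
rewrite wmA; apply: iniI_wm; rewrite eP.
have [e L _] := lead_ini wv P0; have hQ : iniI I (ini wv P) by apply: iniI_lead L.
rewrite (wm_sop (proj1 L)); apply: iniID; first exact: iniI_wm.
exact: iniIZ.
Qed.

Definition pev (p : {poly K}) : W := \sum_(k < size p) p`_k *: iter k (wm sop) 1.

Lemma pev_widen N p : (size p <= N)%N -> pev p = \sum_(k < N) p`_k *: iter k (wm sop) 1.
Proof.
move=> le; rewrite /pev (big_ord_widen N (fun k => p`_k *: iter k (wm sop) 1) le).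
rewrite big_mkcond /=; apply: eq_bigr => k _; case: ltnP => // h.
by rewrite nth_default // scale0r.
Qed.

Lemma pev_linear : linear pev.
Proof.
move=> c p q; pose N := maxn (size (c *: p + q)) (maxn (size p) (size q)).
rewrite !(@pev_widen N) ?leq_max ?leqnn ?orbT //.
rewrite scaler_sumr -big_split /=; apply: eq_bigr => k _.
by rewrite coefD coefZ scalerDl scalerA.
Qed.

Lemma pevC c : pev c%:P = c *: 1.
Proof. by rewrite (@pev_widen 1) ?size_polyC_leq1 // big_ord1 coefC. Qed.

Lemma pevMX p : pev (p * 'X) = wm sop (pev p).
Proof.
rewrite (@pev_widen (size p).+1); last first.
  by apply: leq_trans (size_polyMleq _ _) _; rewrite size_polyX addn2.
rewrite big_ord_recl coefMX /= scale0r add0r (lin_sum _ _ _ _ (wm_linear_r sop)).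
by apply: eq_bigr => k _; rewrite coefMX.
Qed.

Lemma pevM p q : pev (p * q) = wm (pev p) (pev q).
Proof.
elim/poly_ind: p => [|p c IH].
  by rewrite mul0r (lin0 pev_linear) (lin0 (wm_linear_l _)).
rewrite mulrDl mulrAC mul_polyC !(linD pev_linear) (linZ pev_linear) !pevMX IH pevC.
by rewrite (linD (wm_linear_l _)) (linZ (wm_linear_l _)) wm1l wmA.
Qed.

Lemma pevX : pev 'X = sop.
Proof. by rewrite -[X in pev X]mul1r pevMX pevC scale1r wm1r. Qed.

Lemma ev_pev (E : lmodType K) (X D : 'I_n -> E -> E) (c : K) u p :
  weyl_rep X D -> ev X D sop u = c *: u -> ev X D (pev p) u = p.[c] *: u.
Proof.
move=> rep hs; elim/poly_ind: p => [|p a IH].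
  by rewrite (lin0 pev_linear) (lin0 (ev_linear_l _ _ _)) horner0 scale0r.
rewrite (linD pev_linear) pevMX pevC (linD (ev_linear_l _ _ _)) (ev_wm rep) IH.
rewrite (linZ (ev_linear_r rep _)) hs (linZ (ev_linear_l _ _ _)) ev1.
by rewrite scalerA -scalerDl hornerMXaddC.
Qed.

End InitialIdeal.

(** * Leading components of fractions and the root of the b-function *)

Section Symbols.
Variables (R : realFieldType) (K : numFieldType) (iota : {rmorphism R -> K}).
Variables (n : nat) (w : 'I_n -> R).
Local Notation A := {mpoly K[n]}.
Local Notation E := (ratmod K n).
Local Notation nw := (fun i => - w i).
(** Weights are taken for -w: the top component h collects the terms of f of least w-weight, and t =
    - ord_f(w). *)
Variables (f h : A) (t : R).
Hypotheses (f0 : f != 0) (h0 : h != 0) (fh : lead nw t f h).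

(* [u'] is the component of weight [e] of the fraction [u], whose components of
   higher weight vanish; [1 / f ^ N] counts as having leading form [1 / h ^ N]. *)
Definition symb (e : R) (u u' : E) : Prop := exists N (a a' : A),
  [/\ lead nw (e + t *+ N) a a', u = a%:F / (f ^+ N)%:F & u' = a'%:F / (h ^+ N)%:F].

Let fN0 N : (f ^+ N)%:F != 0 :> {fraction A}.
Proof. by rewrite tofrac_eq0 expf_neq0. Qed.
Let hN0 N : (h ^+ N)%:F != 0 :> {fraction A}.
Proof. by rewrite tofrac_eq0 expf_neq0. Qed.

(** Multiplying numerators by f^M and h^M respectively brings both fractions to larger denominators
    while keeping the leading relation. *)
Lemma symb_widen e u u' N M (a a' : A) :
  lead nw (e + t *+ N) a a' -> u = a%:F / (f ^+ N)%:F -> u' = a'%:F / (h ^+ N)%:F ->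
  [/\ lead nw (e + t *+ (N + M)) (a * f ^+ M) (a' * h ^+ M),
      u = (a * f ^+ M)%:F / (f ^+ (N + M))%:F & u' = (a' * h ^+ M)%:F / (h ^+ (N + M))%:F].
Proof.
move=> L -> ->; split; first by rewrite mulrnDr addrA; apply: leadM => //; apply: leadXn.
  by rewrite exprD !tofracM -mulf_div divff ?mulr1.
by rewrite exprD !tofracM -mulf_div divff ?mulr1.
Qed.

Lemma symbD e u u' z z' : symb e u u' -> symb e z z' -> symb e (u + z) (u' + z').
Proof.
move=> [N [a [a' [L1 hu hu']]]] [M [b [b' [L2 hz hz']]]].
have [L3 -> ->] := symb_widen M L1 hu hu'.
have [L4 -> ->] := symb_widen N L2 hz hz'.
exists (N + M)%N, (a * f ^+ M + b * f ^+ N), (a' * h ^+ M + b' * h ^+ N).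
rewrite ![(M + N)%N]addnC in L4 *; split; first exact: leadD.
  by rewrite tofracD mulrDl.
by rewrite tofracD mulrDl.
Qed.

Lemma symbZ e c u u' : symb e u u' -> symb e (c *: u) (c *: u').
Proof.
move=> [N [a [a' [L -> ->]]]]; exists N, (c *: a), (c *: a'); split; first exact: leadZ.
  by rewrite scale_ratE -mul_mpolyC tofracM mulrA.
by rewrite scale_ratE -mul_mpolyC tofracM mulrA.
Qed.

Lemma symb0 e : symb e 0 0.
Proof.
exists 0%N, 0, 0; rewrite !tofrac0 !mul0r; split => //.
by apply: lead_wlt; apply: wsupp0.
Qed.

Lemma symb_lt e e' u u' : e < e' -> symb e u u' -> symb e' u 0.
Proof.
move=> lt [N [a [a' [L -> _]]]]; exists N, a, 0; rewrite tofrac0 mul0r; split => //.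
apply: lead_wlt; apply: wsupp_sub (lead_wle L) => x /le_lt_trans; apply.
by rewrite ltrD2r.
Qed.

(** The numerator of a zero fraction is 0, so its component a' is homogeneous and also of strictly
    lower weight. This makes the component well defined. *)
Lemma symb_eq0 e u' : symb e 0 u' -> u' = 0.
Proof.
move=> [N [a [a' [[L1 L2] hu ->]]]].
move/esym/eqP: hu; rewrite mulf_eq0 invr_eq0 (negPf (fN0 N)) orbF tofrac_eq0 => /eqP a0.
suff -> : a' = 0 by rewrite tofrac0 mul0r.
apply: whom_wlt0 L1 _; rewrite -[a']opprK; apply: wsuppN.
by rewrite -[- a']add0r -a0.
Qed.

Lemma symb_x i e u u' : symb e u u' -> symb (e + wv w (xidx i)) (ratx i u) (ratx i u').
Proof.
move=> [N [a [a' [L -> ->]]]]; exists N, ('X_i * a), ('X_i * a'); split.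
- rewrite wv_x addrAC addrC; apply: leadM => //; apply: lead_whom.
  by apply: wsuppX; rewrite vwU.
- by rewrite /ratx tofracM mulrA.
by rewrite /ratx tofracM mulrA.
Qed.

Lemma symb_d i e u u' : symb e u u' -> symb (e + wv w (didx i)) (dfr i u) (dfr i u').
Proof.
move=> [N [a [a' [L -> ->]]]]; rewrite !dfr_frac ?expf_neq0 // -!exprD.
have LN := leadXn N fh.
exists (N + N)%N, (a^`M(i) * f ^+ N - a * (f ^+ N)^`M(i)),
  (a'^`M(i) * h ^+ N - a' * (h ^+ N)^`M(i)); split => //.
(* A derivative in x_i raises the (-w)-weight by w_i, the weight of d_i; the quotient rule turns the
   exponent N into N + N. *)
have e1 : e + wv w (didx i) + t *+ (N + N) = e + t *+ N - nw i + t *+ N.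
  by rewrite wv_d mulrnDr opprK !addrA; congr (_ + _); rewrite addrAC.
apply: leadB; first by rewrite e1; apply: leadM => //; apply: lead_deriv.
by rewrite e1 -addrA [- _ + _]addrC; apply: leadM => //; apply: lead_deriv.
Qed.

Lemma symb_mop m e u u' : symb e u u' ->
  symb (e + vw (wv w) m) (mop (@ratx K n) (@dfr K n) m u) (mop (@ratx K n) (@dfr K n) m u').
Proof.
apply: mop_shift => [i d z z'|i d z z']; [exact: symb_x | exact: symb_d].
Qed.

(** Split P as (P - Q) + Q: terms of P - Q have weight below kappa and contribute 0 at weight e +
    kappa, terms of Q have weight exactly kappa. *)
Lemma ev_symb kappa P Q e u u' : lead (wv w) kappa P Q -> symb e u u' ->
  symb (e + kappa) (ev (@ratx K n) (@dfr K n) P u) (ev (@ratx K n) (@dfr K n) Q u').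
Proof.
move=> L su; have [L1 L2] := L; rewrite -[P](subrK Q).
rewrite (linD (ev_linear_l _ _ _)) -[ev _ _ Q u']add0r; apply: symbD.
  rewrite /ev /lext big_seq; apply: (big_ind (fun z => symb (e + kappa) z 0)).
  - exact: symb0.
  - by move=> x y hx hy; rewrite -[0]addr0; apply: symbD.
  move=> m /L2 lt; rewrite -[0](scaler0 _ ((P - Q)@_m)); apply: symbZ.
  by apply: symb_lt (symb_mop m su); rewrite ltrD2l.
rewrite /ev /lext big_seq [in X in symb _ _ X]big_seq.
apply: (big_ind2 (symb (e + kappa))).
- exact: symb0.
- by move=> *; apply: symbD.
by move=> m /L1 /eqP <-; apply: symbZ; apply: symb_mop.
Qed.

Lemma symb_expz l : symb (t *~ l) ((f%:F : E) ^ l) ((h%:F : E) ^ l).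
Proof.
case: l => k.
  exists 0%N, (f ^+ k), (h ^+ k); rewrite !expr0 !tofrac1 !divr1 mulr0n addr0.
  by split; rewrite ?tofracXn //; apply: leadXn.
(* For l = -(k+1) the numerator is 1, of weight 0 = t l + t (k+1). *)
exists k.+1, 1, 1; rewrite !tofrac1 !div1r !tofracXn; split => //.
by rewrite NegzE mulrNz addNr; apply: lead1.
Qed.

Definition annz (g : A) (l : int) (P : {mpoly K[n + n]}) : Prop :=
  ev (@ratx K n) (@dfr K n) P ((g%:F : E) ^ l) = 0.

(** If P kills f^l, then the component of P . f^l at the top weight is in(P) . h^l, which must
    vanish; left multiples are then killed too. *)
Lemma iniI_annz l Q : iniI w (annz f l) Q -> annz h l Q.
Proof.
move=> [s [hs ->]]; rewrite /annz (lin_sum1 _ _ _ (ev_linear_l _ _ _)).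
rewrite big_seq big1 // => a /hs [P [IP [P0 eP]]].
rewrite (ev_wm (weyl_rep_ratmod K n)) eP.
have [e L _] := lead_ini (wv w) P0.
have := ev_symb L (symb_expz l); rewrite IP => /symb_eq0 ->.
exact: (lin0 (ev_linear_r (weyl_rep_ratmod K n) _)).
Qed.

Lemma ev_sopE u : ev (@ratx K n) (@dfr K n) (sop iota w) u =
  \sum_(i < n) iota (w i) *: ratx i (dfr i u).
Proof.
rewrite /sop (lin_sum _ _ _ _ (ev_linear_l _ _ _)); apply: eq_bigr => i _.
have rep := weyl_rep_ratmod K n.
rewrite -/(lx i _) (ev_lx rep) -['X_(didx i)]mulr1; congr (_ *: ratx i _).
suff -> : 'X_(didx i) * 1 = ld i 1 :> {mpoly K[n + n]} by rewrite (ev_ld rep) ev1.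
by rewrite /ld mderiv1 addr0.
Qed.

Definition eulerop (u : E) : E := \sum_(i < n) iota (w i) *: ratx i (dfr i u).

Lemma euleropM u z : eulerop (u * z) = eulerop u * z + u * eulerop z.
Proof.
rewrite /eulerop mulr_suml mulr_sumr -big_split; apply: eq_bigr => i _ /=.
by rewrite dfrM /ratx !scale_ratE; ring.
Qed.

Lemma eulerop1 : eulerop 1 = 0.
Proof.
by rewrite /eulerop big1 // => i _; rewrite dfr1 /ratx mulr0 scaler0.
Qed.

Lemma eulerop_h : eulerop (h%:F) = iota (- t) *: (h%:F : E).
Proof.
have := euler iota (proj1 fh) => /(congr1 (fun p => - (p%:F : E))).
rewrite rmorphN scaleNr (lin_sum _ _ _ _ (@tofrac_linear K n)) (linZ (@tofrac_linear K n)).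
move=> <-; rewrite -sumrN; apply: eq_bigr => i _.
by rewrite dfr_tofrac /ratx -tofracM rmorphN scaleNr opprK.
Qed.

Lemma eulerop_exp k (u : E) c : eulerop u = c *: u -> eulerop (u ^+ k) = (c *+ k) *: u ^+ k.
Proof.
move=> hu; elim: k => [|k IH]; first by rewrite expr0 eulerop1 mulr0n scale0r.
rewrite exprS euleropM hu IH mulrS scalerDl !scale_ratE.
by congr (_ + _); [rewrite mulrA | rewrite mulrCA].
Qed.

Lemma eulerop_expz l : eulerop ((h%:F : E) ^ l) = iota (- t *~ l) *: (h%:F : E) ^ l.
Proof.
have hk k : eulerop ((h%:F : E) ^+ k) = iota (- t *+ k) *: (h%:F : E) ^+ k.
  by rewrite (eulerop_exp k eulerop_h) rmorphMn.
case: l => k; first exact: hk.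
rewrite NegzE mulrNz -exprnN rmorphN scaleNr.
set z : E := h%:F ^+ k.+1; have z0 : z != 0 by rewrite expf_neq0 // tofrac_eq0.
(* The derivation applied to z z^-1 = 1 determines its value on the inverse. *)
have := euleropM z z^-1; rewrite divff // eulerop1 hk -/z.
move/esym/eqP; rewrite addrC addr_eq0 => /eqP /(canRL (mulKf z0)) ->.
by rewrite mulrN scale_ratE -mulrA divff // mulr1 scale_ratE [X in - X]mulrC.
Qed.

(** s acts on h^l as the scalar - t l, so p(s) acts as p(- t l), and h^l is nonzero. *)
Lemma root_pev l p : annz h l (pev iota w p) -> p.[iota (- t *~ l)] = 0.
Proof.
rewrite /annz (ev_pev _ (weyl_rep_ratmod K n) (c := iota (- t *~ l))); last first.
  by rewrite ev_sopE; apply: eulerop_expz.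
move/eqP; rewrite scale_ratE mulf_eq0 tofrac_eq0 mpolyC_eq0 => /orP [/eqP //|].
by rewrite expfz_eq0 tofrac_eq0 (negPf h0) andbF.
Qed.

End Symbols.

(** * Moving between polynomials by operators of bounded weight *)

Lemma mnm_case k (m : 'X_{1..k}) : m = 0%MM \/ exists i m', m = (m' + U_(i))%MM.
Proof.
have [/forallP h|] := boolP [forall i, m i == 0%N].
  by left; apply/mnmP => i; rewrite mnm0E; apply/eqP.
rewrite negb_forall => /existsP [i mi]; right; exists i, (m - U_(i))%MM.
by rewrite submK //; apply/mnm_lepP => j; rewrite mnm1E; case: eqP => // <-; rewrite lt0n.
Qed.

Lemma mnm_ind k (P : 'X_{1..k} -> Prop) : P 0%MM ->
  (forall m i, P m -> P (m + U_(i))%MM) -> forall m, P m.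
Proof.
move=> P0 PS m; have [d le] := ubnP (mdeg m); elim: d m le => // d IH m le.
have [->//|[i [m' em]]] := mnm_case m; rewrite em; apply: PS; apply: IH.
by move: le; rewrite em mdegD mdeg1 addn1.
Qed.

Section Reachability.
Variables (R : realFieldType) (K : numFieldType) (iota : {rmorphism R -> K}).
Variables (n : nat) (w : 'I_n -> R).
Local Notation A := {mpoly K[n]}.
Local Notation evp := (ev (@px K n) (@pd K n)).
Local Notation nw := (fun i => - w i).
Local Notation rep := (weyl_rep_poly K n).

(** Weight bounds add under composition, so operators can be built step by step without being
    written down. *)
Definition reach (a : R) (u z : A) : Prop := exists2 P, wle (wv w) a P & evp P u = z.

Lemma reach_trans a b u y z : reach a u y -> reach b y z -> reach (a + b) u z.
Proof.
move=> [P hP <-] [Q hQ <-]; exists (wm Q P); last exact: (ev_wm rep).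
by rewrite addrC; apply: wle_wm => //; apply: wv_ge0.
Qed.

Lemma reachB a u y z : reach a u y -> reach a u z -> reach a u (y - z).
Proof.
move=> [P hP <-] [Q hQ <-]; exists (P - Q); first exact: wsuppB.
by rewrite -!scaleN1r (linD (ev_linear_l _ _ _)) (linZ (ev_linear_l _ _ _)).
Qed.

Lemma reachZ a c u z : reach a u z -> reach a u (c *: z).
Proof.
move=> [P hP <-]; exists (c *: P); first exact: wsuppZ.
by rewrite (linZ (ev_linear_l _ _ _)).
Qed.

Lemma reach_id u : reach 0 u u.
Proof. by exists 1; [apply: whom_wle; case: (lead1 K (wv w)) | rewrite ev1]. Qed.

Lemma reach_x i u : reach (- w i) u ('X_i * u).
Proof.
exists (lx i 1); last by rewrite (ev_lx rep) ev1.
by rewrite /lx mulr1; apply: wsuppX; rewrite vwU wv_x.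
Qed.

Lemma reach_d i u : reach (w i) u u^`M(i).
Proof.
exists (ld i 1); last by rewrite (ev_ld rep) ev1.
by rewrite /ld mulr1 mderiv1 addr0; apply: wsuppX; rewrite vwU wv_d.
Qed.

Lemma reach_monomial m : reach (- vw w m) 1 'X_[m].
Proof.
elim/mnm_ind: m => [|m i IH].
  rewrite mpolyX0 /vw big1 ?oppr0; first exact: reach_id.
  by move=> i _; rewrite mnm0E.
rewrite vwD vwU mpolyXD mulrC opprD; apply: reach_trans IH _; exact: reach_x.
Qed.

(** Each derivative removes one variable up to the factor m_i + 1, which is invertible in
    characteristic 0. *)
Lemma reach_one m : reach (vw w m) 'X_[m] 1.
Proof.
elim/mnm_ind: m => [|m i IH].
  rewrite mpolyX0 /vw big1; first exact: reach_id.
  by move=> i _; rewrite mnm0E.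
rewrite vwD vwU addrC; apply: reach_trans IH.
have := reachZ ((m + U_(i))%MM i)%:R^-1 (reach_d i 'X_[m + U_(i)]).
rewrite mderivX scalerA mulVf ?scale1r ?addmK //.
by rewrite mnmDE mnm1E eqxx addn1 pnatr_eq0.
Qed.

(* Each step applies x_i d_i - b_i, which kills one unwanted monomial x^b. *)
Lemma reach_isolate (g : A) m : m \in msupp g -> reach 0 g 'X_[m].
Proof.
have [d le] := ubnP (size (msupp g)); elim: d g le => // d IH g le mg.
have [/hasP [b bg bm]|/hasPn hs] := boolP (has (predC1 m) (msupp g)); last first.
  have -> : 'X_[m] = (g@_m)^-1 *: g.
    apply/mpolyP => m'; rewrite mcoeffZ mcoeffX; have [<-|ne] := eqVneq m m'.
      by rewrite mulVf // -mcoeff_msupp.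
    rewrite [g@_m']memN_msupp_eq0 ?mulr0 //; apply: contra ne => /hs /=.
    by rewrite negbK eq_sym.
  by apply: reachZ; apply: reach_id.
have [i bi] : exists i, b i != m i.
  apply/existsP; rewrite -negb_forall; apply: contra bm => /forallP h.
  by apply/eqP/mnmP => i; apply/eqP.
pose g' := 'X_i * g^`M(i) - (b i)%:R *: g.
have cg' a : g'@_a = ((a i)%:R - (b i)%:R) * g@_a.
  by rewrite mcoeffB mcoeffZ mcoeff_theta mulrBl.
have gg' : reach 0 g g'.
  apply: reachB; last by apply: reachZ; apply: reach_id.
  by rewrite -(subrr (w i)); apply: reach_trans (reach_d i g) (reach_x i _).
rewrite -[0]addr0; apply: reach_trans gg' _; apply: IH; last first.
  rewrite mcoeff_msupp cg' mulf_neq0 ?subr_eq0 ?eqr_nat -?mcoeff_msupp //.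
  by rewrite eq_sym.
rewrite -ltnS; apply: leq_trans le; rewrite ltnS.
have sub : {subset b :: msupp g' <= msupp g}.
  move=> a; rewrite inE => /orP [/eqP ->//|]; rewrite !mcoeff_msupp cg'.
  by rewrite mulf_eq0 negb_or => /andP [].
apply: (uniq_leq_size _ sub); rewrite /= msupp_uniq andbT mcoeff_msupp cg'.
by rewrite subrr mul0r eqxx.
Qed.

Lemma vwN m : vw nw m = - vw w m.
Proof. by rewrite /vw -sumrN; apply: eq_bigr => i _; rewrite mulNrn. Qed.

Lemma initial_euler (g h : A) t : h != 0 -> lead nw t g h ->
  exists P, evp P g = 0 /\ lead (wv w) 0 P (sop iota w - iota (- t) *: 1).
Proof.
move=> h0 L; have [L1 L2] := L.
pose u := evp (sop iota w - iota (- t) *: 1) g.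
(* Monomials are eigenvectors of s, so s + t cancels exactly the terms of w-weight -t. *)
have cu m : u@_m = iota (vw w m + t) * g@_m.
  rewrite /u -scaleN1r !(linD (ev_linear_l _ _ _)) !(linZ (ev_linear_l _ _ _)) ev1.
  rewrite /sop (lin_sum _ _ _ _ (ev_linear_l _ _ _)) scaleN1r mcoeffB mcoeffZ.
  rewrite raddf_sum /= rmorphD mulrDl rmorphN mulNr opprK; congr (_ + _).
  rewrite /vw rmorph_sum mulr_suml; apply: eq_bigr => i _.
  rewrite mcoeffZ -/(lx i _) (ev_lx rep) -['X_(didx i)]mulr1.
  have -> : 'X_(didx i) * 1 = ld i 1 :> {mpoly K[n + n]} by rewrite /ld mderiv1 addr0.
  by rewrite (ev_ld rep) ev1 mcoeff_theta rmorphMn -[in RHS]mulr_natr mulrA.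
have hu m : m \in msupp u -> vw nw m < t.
  rewrite mcoeff_msupp cu mulf_eq0 negb_or fmorph_eq0 -mcoeff_msupp => /andP [ne mg].
  rewrite lt_neqAle (lead_wle L) // andbT vwN; apply: contra ne => /eqP <-.
  by rewrite subrr.
have [m mh] : exists m, m \in msupp h.
  move: h0; rewrite -msupp_eq0; case: (msupp h) => // m s _.
  by exists m; rewrite mem_head.
have tm : vw w m = - t by rewrite -(eqP (L1 _ mh)) vwN opprK.
have mg : m \in msupp g.
  rewrite mcoeff_msupp -(subrK h g) mcoeffD memN_msupp_eq0 ?add0r -?mcoeff_msupp //.
  by apply/negP => /L2; rewrite vwN tm opprK ltxx.
have [P hP eP] : exists2 P, wlt (wv w) 0 P & evp P g = u.
  rewrite [u]mpolyE big_seq; apply: (big_ind (fun z => exists2 P, wlt (wv w) 0 P & evp P g = z)).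
  - by exists 0; [apply: wsupp0 | apply: (lin0 (ev_linear_l _ _ _))].
  - move=> _ _ [P hP <-] [Q hQ <-]; exists (P + Q); first exact: wsuppD.
    exact: (linD (ev_linear_l _ _ _)).
  (* The route g -> x^m -> 1 -> x^a has weight bound 0 - t - <w, a>, which is negative because <w,
     a> > -t for every monomial a of u. *)
  move=> a au; have := reach_trans (reach_isolate mg) (reach_trans (reach_one m) (reach_monomial a)).
  case=> P hP eP; exists (u@_a *: P); last by rewrite (linZ (ev_linear_l _ _ _)) eP.
  apply: wsuppZ; apply: wsupp_sub hP => x /le_lt_trans; apply.
  by rewrite add0r tm -vwN addrC subr_lt0 hu.
exists (sop iota w - iota (- t) *: 1 - P); split.
  by rewrite -(scaleN1r P) (linD (ev_linear_l _ _ _)) (linZ (ev_linear_l _ _ _)) eP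
    scaleN1r subrr.
split; last by rewrite addrAC subrr sub0r; apply: wsuppN.
apply: wsuppB; first exact: sop_whom.
by apply: wsuppZ; case: (lead1 K (wv w)).
Qed.

End Reachability.

(** * The Bernstein filtration by total degree *)

Section BernsteinFiltration.
Variables (K : numFieldType) (k : nat).

(** Total degree is the weight with all entries 1; in this form the lemmas on weights, including
    [wle_wm], apply to it. *)
Definition bern (d : nat) (P : {mpoly K[k]}) := wle (fun _ : 'I_k => 1 : int) d%:Z P.

Lemma vw1 (m : 'X_{1..k}) : vw (fun _ => 1 : int) m = (mdeg m)%:Z.
Proof.
by rewrite mdegE -natz natr_sum.
Qed.

Lemma bernP d P : bern d P <-> forall m, m \in msupp P -> (mdeg m <= d)%N.
Proof. by split => h m /h; rewrite vw1 lez_nat. Qed.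

Lemma bern_le d e P : (d <= e)%N -> bern d P -> bern e P.
Proof. by move=> de /bernP h; apply/bernP => m /h /leq_trans; apply. Qed.

Lemma bernX m : bern (mdeg m) 'X_[m].
Proof. by apply/bernP => m'; rewrite msuppX inE => /eqP ->. Qed.

Lemma bern1 d : bern d 1.
Proof. by apply/bernP => m; rewrite -mpolyX0 msuppX inE => /eqP ->; rewrite mdeg0. Qed.

Lemma bernM d e P Q : bern d P -> bern e Q -> bern (d + e) (P * Q).
Proof. by move=> hP hQ; rewrite /bern PoszD; apply: wsuppM hP hQ _ => *; apply: lerD. Qed.

Lemma bern_deriv d i P : bern d.+1 P -> bern d P^`M(i).
Proof. by move=> hP; apply: wsupp_deriv hP _ => a; rewrite -addn1 PoszD lerBlDr. Qed.

Lemma bern_deriv_le d i P : bern d P -> bern d P^`M(i).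
Proof. by move=> hP; apply: bern_deriv; apply: bern_le hP. Qed.

Lemma bern_ex (P : {mpoly K[k]}) : exists d, bern d P.
Proof. by exists (msize P); apply/bernP => m /msize_mdeg_lt /ltnW. Qed.

(** x_i d/dx_i multiplies the coefficient at m by m_i, so in characteristic 0 a nonzero coefficient
    forces m = 0. *)
Lemma deriv_eq0_const (P : {mpoly K[k]}) : (forall i, P^`M(i) = 0) -> P = P@_0 *: 1.
Proof.
move=> P0; apply/mpolyP => m; rewrite mcoeffZ -mpolyX0 mcoeffX.
have [<-|m0] := eqVneq 0%MM m; first by rewrite mulr1.
rewrite mulr0; apply/eqP; apply: contraNT m0 => Pm.
apply/eqP/mnmP => i; rewrite mnm0E; apply/esym/eqP.
have := mcoeff_theta i P m; rewrite P0 mulr0 mcoeff0 => /esym/eqP.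
by rewrite mulf_eq0 (negPf Pm) orbF pnatr_eq0.
Qed.

End BernsteinFiltration.

(** * Growth of the module generated by 1/f^M *)

Section HilbertFunction.
Variables (K : numFieldType) (n : nat).
Local Notation A := {mpoly K[n]}.
Local Notation E := (ratmod K n).
Variables (f : A) (M D : nat).
Hypotheses (f0 : f != 0) (fD : bern D f).

(** Multiplied through by g, so that the exponent N - 1 does not appear. *)
Lemma mderiv_expn (g : A) i N : g * (g ^+ N)^`M(i) = N%:R *: (g ^+ N * g^`M(i)).
Proof.
elim: N => [|N IH]; first by rewrite expr0 mderiv1 mulr0 scale0r.
rewrite exprS mderivM mulrDr IH -[in RHS]natr1 scalerDl scale1r addrC.
by rewrite -scalerAr -!mulrA; congr (_ *: _ + _); rewrite [g^`M(i) * _]mulrC.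
Qed.

(** After cancellation a derivative raises the exponent of f by one instead of doubling it, so
    numerators grow only linearly in degree. *)
Lemma dfr_div_exp i (a : A) N : dfr i (a%:F / (f ^+ N)%:F) =
  (a^`M(i) * f - N%:R *: (a * f^`M(i)))%:F / (f ^+ N.+1)%:F :> E.
Proof.
rewrite dfr_frac ?expf_neq0 //; apply/eqP; rewrite eq_frac ?mulf_neq0 ?expf_neq0 //.
apply/eqP; rewrite exprS; have := mderiv_expn f i N.
move: (f ^+ N) ((f ^+ N)^`M(i)) => F G e.
have -> : (a^`M(i) * F - a * G) * (f * F) = a^`M(i) * f * (F * F) - a * F * (f * G) by ring.
by rewrite e -!mul_mpolyC; ring.
Qed.

(** Every generator adds one factor f to the denominator and at most D + 1 to the degree of the
    numerator. *)
Lemma mop_denominator m d : (mdeg m <= d)%N -> exists2 a : A, bern (d * D.+1) a &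
  mop (@ratx K n) (@dfr K n) m ((f%:F : E) ^- M) = a%:F / (f ^+ (M + d))%:F.
Proof.
pose G (e : int) (u _ : E) := exists2 c : nat, e = c%:Z &
  exists2 a : A, bern (c * D.+1) a & u = a%:F / (f ^+ (M + c))%:F.
have fc0 c : (f ^+ c)%:F != 0 :> {fraction A} by rewrite tofrac_eq0 expf_neq0.
have GX i e u u' : G e u u' -> G (e + 1) (ratx i u) (ratx i u').
  move=> [c -> [a ha ->]]; exists c.+1; first by rewrite -PoszD addn1.
  exists ('X_i * a * f).
    have -> : (c.+1 * D.+1 = 1 + c * D.+1 + D)%N by rewrite mulSn add1n !addSn addnC.
    by apply: bernM fD; apply: bernM ha; rewrite -[1%N](mdeg1 i); apply: bernX.
  by rewrite /ratx addnS exprSr !tofracM -mulf_div divff ?mulr1 ?mulrA // tofrac_eq0.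
have GD i e u u' : G e u u' -> G (e + 1) (dfr i u) (dfr i u').
  move=> [c -> [a ha ->]]; exists c.+1; first by rewrite -PoszD addn1.
  exists (a^`M(i) * f - (M + c)%:R *: (a * f^`M(i))); last first.
    by rewrite dfr_div_exp addnS.
  apply: (@bern_le _ _ (c * D.+1 + D)); first by rewrite mulSn addnC leq_add2r.
  apply: wsuppB; first by apply: bernM => //; apply: bern_deriv_le.
  by apply: wsuppZ; apply: bernM => //; apply: bern_deriv_le.
move=> le; have : G 0 ((f%:F : E) ^- M) 0.
  exists 0%N => //; exists 1; first exact: bern1.
  by rewrite addn0 tofracXn tofrac1 div1r.
move=> /(mop_shift (v := fun=> 1) (X := @ratx K n) (X' := @ratx K n)
  (D := @dfr K n) (D' := @dfr K n) m GX GD) [c].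
rewrite add0r vw1 => -[<-] [a ha ->].
(* Padding by the missing powers of f gives all operators of degree at most d the same denominator
   f^(M+d). *)
exists (a * f ^+ (d - mdeg m)).
  have -> : (d * D.+1 = mdeg m * D.+1 + (d - mdeg m) * D.+1)%N by rewrite -mulnDl subnKC.
  apply: bernM => //; elim: (d - mdeg m)%N => [|e IH].
    by rewrite expr0; apply: bern1.
  rewrite exprS mulSn; apply: bernM => //; exact: bern_le fD.
have -> : (M + d = M + mdeg m + (d - mdeg m))%N by rewrite -addnA subnKC.
by rewrite [in RHS]exprD !tofracM -mulf_div divff ?mulr1 //.
Qed.

(** A cube of exponents instead of a degree simplex: it is indexed by finite functions, so it has
    exactly B^n elements. *)
Definition box_mnm B (t : {ffun 'I_n -> 'I_B}) : 'X_{1..n} := [multinom (t i : nat) | i < n].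

Lemma bern_box0 B (a : A) : bern B a ->
  (forall t : {ffun 'I_n -> 'I_B.+1}, a@_(box_mnm t) = 0) -> a = 0.
Proof.
move=> /bernP ha h; apply/mpolyP => m; rewrite mcoeff0.
have [ma|/memN_msupp_eq0 //] := boolP (m \in msupp a).
have lt i : (m i < B.+1)%N.
  by rewrite ltnS; apply: leq_trans (ha _ ma); rewrite mdegE (bigD1 i) //= leq_addr.
rewrite -(h [ffun i => Ordinal (lt i)]); congr (_@__).
by apply/mnmP => i; rewrite mnmE ffunE.
Qed.

(** [phi m] lists the coefficients of the numerator of m . f^(-M) over the common denominator; a
    linear relation among these vectors is an operator killing f^(-M). *)
Lemma annz_coords d : exists phi : 'X_{1..n + n} -> 'rV[K]_(#|{ffun 'I_n -> 'I_(d * D.+1).+1}|),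
  forall (c : 'X_{1..n + n} -> K) s, (forall m, m \in s -> (mdeg m <= d)%N) ->
    \sum_(m <- s) c m *: phi m = 0 ->
    annz f (- M%:Z) (\sum_(m <- s) c m *: 'X_[m]).
Proof.
have /choice [a ha] : forall m : 'X_{1..n + n}, exists a : A, (mdeg m <= d)%N ->
    bern (d * D.+1) a /\
    mop (@ratx K n) (@dfr K n) m ((f%:F : E) ^- M) = a%:F / (f ^+ (M + d))%:F.
  move=> m; have [le|] := leqP (mdeg m) d; last by exists 0.
  by have [a h1 h2] := mop_denominator le; exists a.
exists (fun m => \row_j (a m)@_(box_mnm (enum_val j))) => c s hs e0.
rewrite /annz -exprnN (lin_sum _ _ _ _ (ev_linear_l _ _ _)).
have -> : \sum_(m <- s) c m *: ev (@ratx K n) (@dfr K n) 'X_[m] ((f%:F : E) ^- M) =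
    (\sum_(m <- s) c m *: a m)%:F / (f ^+ (M + d))%:F.
  rewrite (lin_sum _ _ _ _ (@tofrac_linear K n)) mulr_suml; apply: eq_big_seq => m /hs /ha [_ h].
  by rewrite evX h !scale_ratE mulrA.
rewrite (_ : \sum_(m <- s) _ = 0) ?tofrac0 ?mul0r //.
apply: bern_box0 (d * D.+1) _ _ _.
  by apply: wsupp_sum => m /hs /ha [h _] _; apply: wsuppZ.
move=> t; move/rowP: e0 => /(_ (enum_rank t)); rewrite summxE mxE => <-.
rewrite raddf_sum /=; apply: eq_bigr => m _.
by rewrite mcoeffZ !mxE enum_rankK.
Qed.

End HilbertFunction.

(** * Finite-dimensional linear algebra *)

Lemma span_map_seq (K : fieldType) (V : vectType K) (T : eqType) (phi : T -> V)
    (s : seq T) (x : V) : uniq s -> x \in <<[seq phi a | a <- s]>>%VS ->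
  exists c : T -> K, x = \sum_(a <- s) c a *: phi a.
Proof.
elim: s x => [|b s IH] x /=.
  by move=> _; rewrite span_nil memv0 => /eqP ->; exists (fun=> 0); rewrite big_nil.
move=> /andP [bs us]; rewrite span_cons => /memv_addP [_ /vlineP [k ->]] [y hy ->].
have [c ->] := IH y us hy; exists (fun a => if a == b then k else c a).
rewrite big_cons eqxx; congr (_ + _); apply: eq_big_seq => a ha.
by case: eqP => // e; rewrite e in ha; rewrite ha in bs.
Qed.

Lemma free_size (K : fieldType) N (s : seq 'rV[K]_N) : free s -> (size s <= N)%N.
Proof.
rewrite /free => /eqP <-; apply: leq_trans (dimvS (subvf _)) _.
by rewrite dimvf /dim /= mul1n.
Qed.

(** The rank of the coefficient matrix is at most the number of columns, so with more rows its left
    kernel has a nonzero row. *)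
Lemma underdetermined (K : fieldType) (V T : finType) (B : V -> T -> K) :
  (#|T| < #|V|)%N ->
  exists2 t : V -> K, (exists v, t v != 0) & forall b, \sum_v t v * B v b = 0.
Proof.
move=> lt; pose X := \matrix_(i < #|V|, j < #|T|) B (enum_val i) (enum_val j).
have ker0 : kermx X != 0.
  rewrite -mxrank_eq0 mxrank_ker subn_eq0 -ltnNge.
  exact: leq_ltn_trans (rank_leq_col _) lt.
have [i ri] : exists i, row i (kermx X) != 0.
  apply/existsP; rewrite -negb_forall; apply: contra ker0 => /forallP h.
  by apply/eqP/row_matrixP => i; rewrite row0; apply/eqP.
exists (fun v => kermx X i (enum_rank v)).
  apply/existsP; rewrite -negb_forall; apply: contra ri => /forallP h.
  apply/eqP/rowP => j; rewrite [LHS]mxE [RHS]mxE.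
  by have := h (enum_val j); rewrite enum_valK => /eqP.
move=> b; have := mulmx_ker X => /matrixP /(_ i (enum_rank b)).
rewrite !mxE => e; rewrite -[RHS]e (reindex (@enum_val V predT)) /=; last first.
  by apply: onW_bij; apply: enum_val_bij.
by apply: eq_bigr => j _; rewrite enum_valK !mxE enum_rankK.
Qed.

(** * Spanning the quotient by the initial ideal; operators with coefficients in powers of s *)

Section Existence.
Variables (R : realFieldType) (K : numFieldType) (iota : {rmorphism R -> K}).
Variables (n : nat) (w : 'I_n -> R).
Local Notation W := {mpoly K[n + n]}.
Variable I : W -> Prop.
Local Notation J := (iniI w I).
Local Notation vwt := (vw (wv w)).
Local Notation sop := (sop iota w).

(** Greedy choice from lowest weight upwards: a monomial is kept if its vector is independent of
    those already kept. Otherwise the dependence is an element of I, and its component at the weight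
    of the monomial expresses it modulo J through kept monomials. *)
Lemma initial_basis N (phi : 'X_{1..n + n} -> 'rV[K]_N) (s : seq 'X_{1..n + n}) :
  sorted (fun m m' => vwt m' <= vwt m) s -> uniq s ->
  (forall c s', {subset s' <= s} -> \sum_(m <- s') c m *: phi m = 0 ->
     I (\sum_(m <- s') c m *: 'X_[m])) ->
  exists S : seq 'X_{1..n + n}, [/\ {subset S <= s}, uniq S,
    free [seq phi m | m <- S] &
    forall m, m \in s -> exists c : 'X_{1..n + n} -> K,
      J ('X_[m] - \sum_(a <- S) c a *: 'X_[a])].
Proof.
elim: s => [|m s IH] /=.
  by move=> _ _ _; exists [::]; split => //; rewrite nil_free.
move=> srt /andP [ms us] rel.
have mle a : a \in s -> vwt a <= vwt m.
  move=> ha; have tr : transitive (fun m m' => vwt m' <= vwt m).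
    by move=> y x z h1 h2; apply: le_trans h2 h1.
  by move/(order_path_min tr)/allP: srt => /(_ a ha).
have [|S [Ss uS fS gS]] := IH (path_sorted srt) us.
  by move=> c s' sub; apply: rel => a /sub; rewrite inE orbC => ->.
have mS : m \notin S by apply: contra ms => /Ss.
have Ss' : {subset S <= m :: s} by move=> a /Ss; rewrite inE orbC => ->.
have [inS|notS] := boolP (phi m \in <<[seq phi a | a <- S]>>%VS); last first.
  exists (m :: S); split => //=.
  - by move=> a; rewrite inE => /orP [/eqP ->|/Ss']; rewrite ?mem_head.
  - by rewrite mS.
  - by rewrite free_cons notS.
  move=> a; rewrite inE; have [->|ne] := eqVneq a m => /= [_|/gS [c hc]].
    exists (fun b => (b == m)%:R); rewrite big_cons eqxx scale1r.
    rewrite big_seq big1 ?addr0 ?subrr; first exact: iniI0.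
    by move=> b hb; case: eqP => [e|_]; [rewrite -e hb in mS | rewrite scale0r].
  exists (fun b => if b == m then 0 else c b); rewrite big_cons eqxx scale0r add0r.
  rewrite (eq_big_seq (fun b => c b *: 'X_[b])) // => b hb.
  by case: eqP => // e; rewrite -e hb in mS.
have [c hc] := span_map_seq uS inS.
exists S; split => // a; rewrite inE => /orP [/eqP ->|/gS //].
(* Passing to the leading component discards the kept monomials of weight below that of m. *)
exists (fun b => if vwt b == vwt m then c b else 0).
pose c' b := if b == m then 1 else - c b.
have eS (V : lmodType K) (F : 'X_{1..n + n} -> V) :
    \sum_(b <- m :: S) c' b *: F b = F m - \sum_(b <- S) c b *: F b.
  rewrite big_cons /c' eqxx scale1r -sumrN; congr (_ + _); apply: eq_big_seq => b hb.
  by case: eqP => [e|_]; [rewrite -e hb in mS | rewrite scaleNr].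
apply: (@iniI_lead _ _ _ _ _ (vwt m) ('X_[m] - \sum_(b <- S) c b *: 'X_[b])).
  rewrite -eS; apply: rel; last by rewrite eS -hc subrr.
  by move=> b; rewrite inE => /orP [/eqP ->|/Ss']; rewrite ?mem_head.
split.
  apply: wsuppB; first by apply: wsuppX.
  apply: wsupp_sum => b _ _; case: ifP => h; last by rewrite scale0r; apply: wsupp0.
  by apply: wsuppZ; apply: wsuppX.
rewrite opprB addrC addrA subrK -sumrB; apply: wsupp_sum => b /Ss /mle le _.
case: ifP => h; first by rewrite subrr; apply: wsupp0.
by rewrite scale0r sub0r; apply/wsuppN/wsuppZ/wsuppX; rewrite lt_neqAle h.
Qed.

(** Applying the greedy choice to all monomials of degree at most d transfers the dimension bound
    from I to J. *)
Lemma initial_basis_bern N d (phi : 'X_{1..n + n} -> 'rV[K]_N) :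
  (forall (c : 'X_{1..n + n} -> K) s, (forall m, m \in s -> (mdeg m <= d)%N) ->
    \sum_(m <- s) c m *: phi m = 0 -> I (\sum_(m <- s) c m *: 'X_[m])) ->
  exists S : seq 'X_{1..n + n}, [/\ (size S <= N)%N, forall m, m \in S -> (mdeg m <= d)%N &
    forall P, bern d P -> exists c : 'X_{1..n + n} -> K,
      J (P - \sum_(a <- S) c a *: 'X_[a])].
Proof.
move=> rel; pose r := fun m m' : 'X_{1..n + n} => vwt m' <= vwt m.
pose s := sort r [seq bmnm m | m <- enum {: bmultinom (n + n) d.+1}].
have ss m : (m \in s) = (mdeg m <= d)%N.
  rewrite mem_sort; apply/mapP/idP => [[b _ ->]|le]; first by rewrite -ltnS bmdeg.
  by exists (BMultinom (le : mdeg m < d.+1)%N); rewrite ?mem_enum.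
have [|||S [Ss uS fS gS]] := @initial_basis N phi s.
- by apply: sort_sorted => x y; rewrite /r orbC le_total.
- by rewrite sort_uniq map_inj_uniq ?enum_uniq //; apply: val_inj.
- by move=> c s' sub; apply: rel => m /sub; rewrite ss.
exists S; split => [|m /Ss|P /bernP hP].
- by rewrite -(size_map phi); apply: free_size.
- by rewrite ss.
rewrite [P]mpolyE big_seq.
apply: (big_ind (fun P => exists c : 'X_{1..n + n} -> K,
   J (P - \sum_(a <- S) c a *: 'X_[a]))).
- exists (fun=> 0); rewrite big1 ?subr0; first exact: iniI0.
  by move=> a _; rewrite scale0r.
- move=> P1 P2 [c1 h1] [c2 h2]; exists (fun a => c1 a + c2 a).
  under eq_bigr do rewrite scalerDl; rewrite big_split /= opprD addrACA.
  exact: iniID.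
move=> m /hP; rewrite -ss => /gS [c h]; exists (fun a => P@_m * c a).
under eq_bigr do rewrite -scalerA; rewrite -scaler_sumr -scalerBr.
exact: iniIZ.
Qed.

Definition spow i := iter i (wm sop) 1.

(** The operator sum_i P_i s^i with P_i multiplying on the left and s on the right. It descends to
    D/J, J being stable under both. *)
Definition tact q (P : 'I_q -> W) (Q : W) : W := \sum_(i < q) wm (wm (P i) Q) (spow i).

Lemma iniI_spow Q i : J Q -> J (wm Q (spow i)).
Proof.
elim: i Q => [|i IH] Q hQ; first by rewrite wm1r.
by rewrite /spow iterS -wmA; apply: IH; apply: iniI_sop hQ.
Qed.

Lemma tact_linear q (P : 'I_q -> W) : linear (tact P).
Proof.
move=> a Q Q'; rewrite /tact scaler_sumr -big_split; apply: eq_bigr => i _ /=.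
by rewrite wm_linear_r wm_linear_l.
Qed.

Lemma tact_iniI q (P : 'I_q -> W) Q : J Q -> J (tact P Q).
Proof.
by move=> hQ; apply: iniI_sum => i _; apply: iniI_spow; apply: iniI_wm.
Qed.

Lemma wmBl (P P' Q : W) : wm (P - P') Q = wm P Q - wm P' Q.
Proof. by rewrite -scaleN1r (linD (wm_linear_l Q)) (linZ (wm_linear_l Q)) scaleN1r. Qed.

(** [d_j, P_i] is the derivative of P_i in x_j, so differentiating the coefficients is taking the
    commutator with left multiplication by d_j; [tact_derivd] is the analogue for x_j. *)
Lemma tact_derivx q (P : 'I_q -> W) j Q :
  tact (fun i => (P i)^`M(xidx j)) Q = wm 'X_(didx j) (tact P Q) - tact P (ld j Q).
Proof.
rewrite /tact (lin_sum1 _ _ _ (wm_linear_r _)) -sumrB; apply: eq_bigr => i _.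
have -> : (P i)^`M(xidx j) = wm 'X_(didx j) (P i) - wm (P i) 'X_(didx j).
  by rewrite wm_ld wm_rd /ld /rd addrC addKr.
by rewrite !wmBl -wm_ld !wmA.
Qed.

Lemma tact_derivd q (P : 'I_q -> W) j Q :
  tact (fun i => (P i)^`M(didx j)) Q = tact P (lx j Q) - wm 'X_(xidx j) (tact P Q).
Proof.
rewrite /tact (lin_sum1 _ _ _ (wm_linear_r _)) -sumrB; apply: eq_bigr => i _.
have -> : (P i)^`M(didx j) = wm (P i) 'X_(xidx j) - wm 'X_(xidx j) (P i).
  by rewrite wm_lx wm_rx /lx /rx addrC addKr.
by rewrite !wmBl -wm_lx !wmA.
Qed.

Lemma bern_lx d j (Q : W) : bern d Q -> bern d.+1 (lx j Q).
Proof. by move=> h; rewrite -add1n; apply: bernM h; rewrite -(mdeg1 (xidx j)); apply: bernX. Qed.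

Lemma bern_ld d j (Q : W) : bern d Q -> bern d.+1 (ld j Q).
Proof.
move=> h; have h1 : bern d.+1 Q^`M(xidx j).
  by apply: (bern_le (leqnSn d)); apply: bern_deriv_le.
have h2 : bern d.+1 ('X_(didx j) * Q).
  by rewrite -add1n; apply: bernM h; rewrite -(mdeg1 (didx j)); apply: bernX.
exact: (wsuppD h2 h1).
Qed.

Lemma bern0_const (P : W) : bern 0 P -> P = P@_0 *: 1.
Proof.
move=> /bernP h; apply/mpolyP => m; rewrite mcoeffZ -mpolyX0 mcoeffX.
have [<-|m0] := eqVneq 0%MM m; first by rewrite mulr1.
rewrite mulr0 memN_msupp_eq0 //; apply: contra m0 => /h.
by rewrite leqn0 mdeg_eq0 eq_sym.
Qed.

Lemma pevXn i : pev iota w 'X^i = spow i.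
Proof.
elim: i => [|i IH]; first by rewrite expr0 -polyC1 pevC scale1r.
by rewrite exprSr pevMX IH.
Qed.

(** With constant coefficients the value at 1 is p(s) for p = sum_i c_i X^i, so membership in J
    makes p vanish. *)
Lemma tact_const q (P : 'I_q -> W) (c : 'I_q -> K) :
  (forall p, J (pev iota w p) -> p = 0) -> (forall i, P i = c i *: 1) ->
  J (tact P 1) -> forall i, P i = 0.
Proof.
move=> Js Pc JP i; rewrite Pc.
have p0 : \sum_(i < q) c i *: 'X^i = 0 :> {poly K}.
  apply: Js; rewrite (lin_sum _ _ _ _ (pev_linear iota w)).
  congr (J _) : JP; apply: eq_bigr => j _.
  by rewrite wm1r Pc (linZ (wm_linear_l _)) wm1l pevXn.
have := congr1 (fun p : {poly K} => p`_i) p0; rewrite coef0 coef_sum.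
rewrite (bigD1 i) //= big1 ?addr0; last first.
  by move=> j ne; rewrite coefZ coefXn eq_sym (negPf ne : (j == i :> nat) = false) mulr0.
by rewrite coefZ coefXn eqxx mulr1 => ->; rewrite scale0r.
Qed.

(* Commutators with the generators lower the order of the coefficients of T, so
   an operator T annihilating the degree-d part of D/J has constant coefficients. *)
Lemma tact_inj q d (P : 'I_q -> W) :
  (forall p, J (pev iota w p) -> p = 0) -> (forall i, bern d (P i)) ->
  (forall Q, bern d Q -> J (tact P Q)) -> forall i, P i = 0.
Proof.
move=> Js; elim: d P => [|d IH] P bP JP.
  apply: (tact_const (c := fun i => (P i)@_0)) => //.
    by move=> i; apply: bern0_const.
  by apply: JP; apply: bern1.
have P0 a i : (P i)^`M(a) = 0.
  apply: (IH (fun i => (P i)^`M(a))) => [j|Q hQ]; first exact: bern_deriv.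
  have hQ' := bern_le (leqnSn d) hQ.
  have [j ->|j ->] := split_ordP a; rewrite -/(xidx j) -/(didx j).
    rewrite tact_derivx; apply: iniIB; first by apply: iniI_wm; apply: JP.
    by apply: JP; apply: bern_ld.
  rewrite tact_derivd; apply: iniIB; first by apply: JP; apply: bern_lx.
  by apply: iniI_wm; apply: JP.
apply: (tact_const (c := fun i => (P i)@_0)) => //.
  by move=> i; apply: deriv_eq0_const => a; apply: P0.
by apply: JP; apply: bern1.
Qed.

Lemma bern_wm d e (P Q : W) : bern d P -> bern e Q -> bern (d + e) (wm P Q).
Proof. by move=> hP hQ; rewrite /bern PoszD; apply: wle_wm. Qed.

Lemma bern_spow i : bern (2 * i) (spow i).
Proof.
elim: i => [|i IH]; first exact: bern1.
rewrite mulnS /spow iterS; apply: bern_wm IH; apply: wsupp_sum => j _ _.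
apply: wsuppZ; apply: (@bernM _ _ 1 1).
  by rewrite -(mdeg1 (xidx j)); apply: bernX.
by rewrite -(mdeg1 (didx j)); apply: bernX.
Qed.

End Existence.

(** * The dimension count producing a nonzero polynomial in s *)

Lemma leq_expl a b e : (a <= b)%N -> (a ^ e <= b ^ e)%N.
Proof. by case: e => // e le; rewrite leq_exp2r. Qed.

Section Counting.
Variables (R : realFieldType) (K : numFieldType) (iota : {rmorphism R -> K}).
Variables (n : nat) (w : 'I_n -> R).
Local Notation W := {mpoly K[n + n]}.
Variable I : W -> Prop.
Local Notation J := (iniI w I).

Lemma monomial_box_sum q (t : {ffun 'I_(n + n) -> 'I_q} -> K) u :
  (\sum_v t v *: 'X_[box_mnm v] : W)@_(box_mnm u) = t u.
Proof.
rewrite raddf_sum /= (bigD1 u) //= big1 ?addr0 ?mcoeffZ ?mcoeffX ?eqxx ?mulr1 // => v vu.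
rewrite mcoeffZ mcoeffX; case: eqP => [e|_]; last by rewrite mulr0.
case/eqP: vu; apply/ffunP => i; apply: val_inj.
by move/mnmP: e => /(_ i); rewrite !mnmE.
Qed.

(* The space of operators sum_i P_i s^i with P_i of order at most 2nq and i <= q has
   dimension at least (q + 1)^(2n+1), whereas annihilating the order-2nq part of D/J
   amounts to O(q^(2n)) linear conditions. *)
Lemma exists_bpoly c :
  (forall d, exists S : seq 'X_{1..n + n}, [/\ (size S <= (d * c).+1 ^ n)%N,
    forall m, m \in S -> (mdeg m <= d)%N &
    forall P, bern d P -> exists a : 'X_{1..n + n} -> K,
      J (P - \sum_(m <- S) a m *: 'X_[m])]) ->
  exists2 p : {poly K}, p != 0 & J (pev iota w p).
Proof.
move=> hS; apply: contrapT => noJ.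
have Js p : J (pev iota w p) -> p = 0.
  by move=> hp; apply: contrapT => /eqP p0; apply: noJ; exists p.
(* C makes both k c + 1 and k2 c + 1 at most C (q+1). With q = C^(2n) the number of equations is at
   most q (q+1)^(2n), less than the (q+1)^(2n+1) unknowns. *)
pose C := ((4 * n + 2) * c).+1; pose q := (C ^ (n + n))%N.
(* k bounds the degree of a monomial with 2n exponents at most q; k2 bounds the order of P Q s^i for
   P, Q of order k and i <= q. *)
pose k := ((n + n) * q)%N; pose k2 := (k + k + 2 * q)%N.
have [S [sS dS gS]] := hS k; have [S' [sS' dS' gS']] := hS k2.
pose x0 : 'X_{1..n + n} := 0%MM.
(* V indexes the unknowns, a box monomial times a power of s; T indexes the matrix entries between
   the spanning sets S and S'. *)
pose V : finType := ({ffun 'I_(n + n) -> 'I_q.+1} * 'I_q.+1)%type.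
pose T : finType := ('I_(size S) * 'I_(size S'))%type.
have cardVT : (#|T| < #|V|)%N.
  rewrite !card_prod card_ffun !card_ord.
  apply: leq_ltn_trans (leq_mul sS sS') _.
  have b1 : (k * c < C * q.+1)%N.
    rewrite /C mulSn addSn ltnS mulnS; apply: leq_trans (leq_addl _ _).
    apply: leq_trans (leq_addl _ _); rewrite /k -!mulnA [(q * c)%N]mulnC !mulnA.
    by rewrite !leq_mul2r; apply/orP; right; apply/orP; right; lia.
  have b2 : (k2 * c < C * q.+1)%N.
    rewrite /C mulSn addSn ltnS mulnS; apply: leq_trans (leq_addl _ _).
    apply: leq_trans (leq_addl _ _); rewrite [leqRHS]mulnAC leq_mul2r.
    by apply/orP; right; rewrite /k2 /k; nia.
  have {b1} b1 : ((k * c).+1 ^ n <= (C * q.+1) ^ n)%N by apply: leq_expl.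
  have {b2} b2 : ((k2 * c).+1 ^ n <= (C * q.+1) ^ n)%N by apply: leq_expl.
  apply: leq_ltn_trans (leq_mul b1 b2) _.
  rewrite -expnD expnMn -/q mulnC ltn_mul2l ltnSn andbT expn_gt0.
  by [].
have bX (v : V) : bern k ('X_[box_mnm v.1] : W).
  apply/bernP => m; rewrite msuppX inE => /eqP ->; rewrite mdegE.
  rewrite /k -[X in (X * _)%N]card_ord -sum_nat_const; apply: leq_sum => i _.
  by rewrite mnmE -ltnS.
(* [a] gives the coordinates in S', modulo J, of the image of a monomial of S under one basic
   operator; outside S it takes the value 0. *)
have /choice [a ha] : forall vm : V * 'X_{1..n + n}, exists a : 'X_{1..n + n} -> K,
    vm.2 \in S -> J (wm (wm 'X_[box_mnm vm.1.1] 'X_[vm.2]) (spow iota w vm.1.2)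
                      - \sum_(b <- S') a b *: 'X_[b]).
  move=> [v m] /=; have [mS|] := boolP (m \in S); last by exists (fun=> 0).
  have [|a ha] := gS' (wm (wm 'X_[box_mnm v.1] 'X_[m]) (spow iota w v.2)); last by exists a.
  apply: bern_wm.
    by apply: bern_wm; [apply: bX|exact: (bern_le (dS m mS) (@bernX K _ m))].
  by apply: (fun H => bern_le H (@bern_spow _ _ iota _ w v.2)); rewrite leq_mul2l -ltnS ltn_ord orbT.
have [t [v tv] ht] := underdetermined
  (fun (v : V) (z : T) => a (v, nth x0 S z.1) (nth x0 S' z.2)) cardVT.
pose P (i : 'I_q.+1) : W := \sum_e t (e, i) *: 'X_[box_mnm e].
(* The coefficients of [P i] at the box monomials are the values of t, so vanishing of every [P i]
   contradicts t != 0. *)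
suff P0 i : P i = 0.
  case/negP: tv; case: v => e i; apply/eqP.
  by rewrite -(monomial_box_sum (fun e => t (e, i)) e) -/(P i) P0 mcoeff0.
apply: (tact_inj (iota := iota) (d := k) Js).
  by move=> j; apply: wsupp_sum => e _ _; apply: wsuppZ; apply: (bX (e, j)).
move=> Q /gS [cQ hQ].
have tactE m : tact iota w P 'X_[m] =
    \sum_(v : V) t v *: wm (wm 'X_[box_mnm v.1] 'X_[m]) (spow iota w v.2).
  rewrite /tact [RHS](eq_bigr (fun v : V => t (v.1, v.2) *:
    wm (wm 'X_[box_mnm v.1] 'X_[m]) (spow iota w v.2))); last by case.
  rewrite -(pair_bigA _ (fun e i => t (e, i) *:
    wm (wm 'X_[box_mnm e] 'X_[m]) (spow iota w i))) exchange_big /=.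
  apply: eq_bigr => j _.
  have wmS F Q' : wm (\sum_e t (e, j) *: F e) Q' = \sum_e t (e, j) *: wm (F e) Q'.
    exact: (lin_sum _ _ _ _ (wm_linear_l Q')).
  by rewrite /P !wmS.
have tJ m : m \in S -> J (tact iota w P 'X_[m]).
  move=> mS; rewrite tactE.
  (* The subtracted expansions add up to 0 by the choice of t, and each remaining difference lies in
     J. *)
  have -> : \sum_(v : V) t v *: wm (wm 'X_[box_mnm v.1] 'X_[m]) (spow iota w v.2) =
     \sum_(v : V) t v *: (wm (wm 'X_[box_mnm v.1] 'X_[m]) (spow iota w v.2)
                      - \sum_(b <- S') a (v, m) b *: 'X_[b]).
    under [RHS]eq_bigr do rewrite scalerBr; rewrite sumrB -[LHS]subr0; congr (_ - _).
    under eq_bigr do rewrite scaler_sumr; rewrite exchange_big /=.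
    rewrite (big_nth x0) big_mkord big1 // => j _.
    under eq_bigr do rewrite scalerA; rewrite -scaler_suml.
    have im : (index m S < size S)%N by rewrite index_mem.
    by have := ht (Ordinal im, j); rewrite /= nth_index // => ->; rewrite scale0r.
  apply: iniI_sum => v' _; apply: iniIZ.
  exact: (ha (v', m)).
rewrite -(subrK (\sum_(m <- S) cQ m *: 'X_[m]) Q) (linD (tact_linear _ _ _)).
apply: iniID; first exact: tact_iniI.
rewrite (lin_sum _ _ _ _ (tact_linear _ _ _)) big_seq; apply: iniI_sum => m mS.
by apply: iniIZ; apply: tJ.
Qed.

End Counting.

(** Euclidean division by a nonzero element of least degree, normalised to be monic. *)
Lemma monic_generator (K : fieldType) (Q : {poly K} -> Prop) :
  (forall p q, Q p -> Q q -> Q (p + q)) -> (forall r p, Q p -> Q (r * p)) ->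
  (exists2 p, p != 0 & Q p) ->
  exists b, b \is monic /\ forall p, Q p <-> b %| p.
Proof.
move=> QD QM [p0 p00 Qp0].
have ex : exists N, `[< exists p, [/\ Q p, p != 0 & size p = N] >].
  by exists (size p0); apply/asboolP; exists p0.
case: (ex_minnP ex) => N /asboolP [b [Qb b0 sb]] minN.
exists ((lead_coef b)^-1 *: b); split; first by rewrite monicE lead_coefZ mulVf // lead_coef_eq0.
move=> p; rewrite dvdpZl ?invr_eq0 ?lead_coef_eq0 //; split => [Qp|/dvdpP [r ->]]; last exact: QM.
rewrite /dvdp; apply: contraT => m0.
have Qm : Q (p %% b).
  have -> : p %% b = p + (- (p %/ b)) * b by rewrite {2}(divp_eq p b) addrC mulNr addKr.
  by apply: QD => //; apply: QM.
have := minN (size (p %% b)); rewrite leqNgt -sb ltn_modp b0 => h.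
by apply: h; apply/asboolP; exists (p %% b).
Qed.

(** * The b-function of f^l over a general field of coefficients *)

Section GenericTheorem.
Variables (R : realFieldType) (K : numFieldType) (iota : {rmorphism R -> K}).
Variables (n : nat) (w : 'I_n -> R) (f h : {mpoly K[n]}) (t : R).
Local Notation nw := (fun i => - w i).
Hypotheses (f0 : f != 0) (h0 : h != 0) (fh : lead nw t f h).
Local Notation J l := (iniI w (annz f l)).
Local Notation c l := (iota (- t *~ l)).

Lemma annz_root l p : J l (pev iota w p) -> p.[c l] = 0.
Proof. by move=> hp; apply: (root_pev h0 fh); apply: (iniI_annz f0 h0 fh). Qed.

Lemma annz_bfun_nat (l : nat) p : J l (pev iota w p) <-> ('X - (c l)%:P) %| p.
Proof.
split=> [/annz_root p0|/dvdpP [q ->]]; first by rewrite dvdp_XsubCl; apply/rootP.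
have -> : pev iota w (q * ('X - (c l)%:P)) = wm (pev iota w q) (sop iota w - c l *: 1).
  rewrite pevM; congr (wm _ _).
  by rewrite -[- _]scaleN1r (linD (pev_linear _ _)) (linZ (pev_linear _ _)) pevX pevC scaleN1r.
apply: iniI_wm.
have hl0 : h ^+ l != 0 by rewrite expf_neq0.
(* For l >= 0 the power f^l is a polynomial, with leading component h^l of weight l t. *)
have [P [eP L]] := initial_euler iota hl0 (leadXn l fh).
rewrite (_ : c l = iota (- (t *+ l))); last by rewrite -pmulrn mulNrn.
apply: (iniI_lead _ L); rewrite /annz -exprnP -tofracXn ev_tofrac eP.
by rewrite tofrac0.
Qed.

Lemma annz_bpoly_neg (M : nat) : exists2 p, p != 0 & J (- M%:Z) (pev iota w p).
Proof.
(* The growth constant is D + 1: numerators of degree at most d (D + 1) have (d (D + 1) + 1)^n box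
   coefficients. *)
have [D fD] := bern_ex f; apply: (@exists_bpoly _ _ _ _ _ _ D.+1) => d.
have [phi hphi] := annz_coords M f0 fD d.
have [S [sS dS gS]] := initial_basis_bern w hphi.
by exists S; split => //; rewrite card_ffun !card_ord in sS.
Qed.

Lemma annz_bfun l : exists b, b \is monic /\ forall p, J l (pev iota w p) <-> b %| p.
Proof.
apply: monic_generator.
- by move=> p q hp hq; rewrite (linD (pev_linear iota w)); apply: iniID.
- by move=> r p hp; rewrite pevM; apply: iniI_wm.
case: l => l; last by rewrite NegzE; apply: annz_bpoly_neg.
by exists ('X - (c l)%:P); [rewrite polyXsubC_eq0 | apply/annz_bfun_nat].
Qed.

End GenericTheorem.

(** * Comparison with the original definitions over the complex numbers *)

Section Transfer.
Variables (R : realType) (n : nat).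
Local Notation C := (R[i]).
Local Notation W := {mpoly C[n + n]}.
Implicit Types (P Q : W).

(** Both sides are linear, and on a monomial the formal derivative is the explicit correction term
    of [lmul_d]. *)
Lemma lmul_d_ld : @lmul_d R n = @ld C n.
Proof.
apply/funext => i; apply/funext.
have l1 : linear (fun P : W => lmul_d i P) by exact: lext_linear.
apply: (eq_lin_mpoly l1 (@ld_linear C n i)) => m.
rewrite [LHS](lextX (fun m => 'X_[(m + U_(didx i))%MM] +
  (xexp m i)%:R *: 'X_[(m - U_(xidx i))%MM] : W)).
by rewrite /ld mderivX mpolyXD mulrC.
Qed.

Lemma wmul_wm P Q : wmul P Q = wm P Q.
Proof. by rewrite /wm -lmul_d_ld. Qed.

Lemma wmulE : @wmul R n = @wm C n.
Proof. by apply/funext => P; apply/funext => Q; apply: wmul_wm. Qed.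

Lemma s_op_sop (iota : {rmorphism R -> C}) w :
  @toC R =1 iota -> @s_op R n w = sop iota w.
Proof. by move=> ti; rewrite /s_op; under eq_bigr do rewrite ti. Qed.

Lemma peval_pev (iota : {rmorphism R -> C}) w p :
  @toC R =1 iota -> peval p (@s_op R n w) = pev iota w p.
Proof. by move=> ti; rewrite (s_op_sop w ti) /peval /wpow wmulE. Qed.

Lemma wt_vw (w : 'I_n -> R) m : wt w m = vw (wv w) m.
Proof.
rewrite /wt /vw big_split_ord /= -big_split /=; apply: eq_bigr => i _ /=.
by rewrite -/(xidx i) -/(didx i) wv_x wv_d mulrBr addrC mulNrn !mulr_natr.
Qed.

Lemma initf_ini w P : initf w P = ini (wv w) P.
Proof.
apply: eq_bigl => m; apply: eq_all => m'.
by rewrite !wt_vw.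
Qed.

Lemma initI_iniI w (I I' : W -> Prop) Q : (forall P, I P <-> I' P) ->
  initI w I Q <-> iniI w I' Q.
Proof.
move=> II'; split=> -[s [hs ->]]; exists s; split.
- by move=> a /hs [P [/II' IP [P0 ->]]]; exists P; rewrite initf_ini.
- by apply: eq_bigr => a _; rewrite wmul_wm.
- by move=> a /hs [P [/II' IP [P0 ->]]]; exists P; rewrite initf_ini.
by apply: eq_bigr => a _; rewrite wmul_wm.
Qed.

Lemma fop_rx e s (u : ratmod C n) :
  fop (@ratx C n) e s u = (\prod_(i <- s) ('X_i)%:F ^+ e i) * u.
Proof.
elim: s => [|j s IH]; first by rewrite big_nil mul1r.
rewrite big_cons -mulrA -IH /fop /= -/(fop _ e s u).
elim: (e j) => [|k IHk] /=; first by rewrite mul1r.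
by rewrite IHk /ratx exprS mulrA.
Qed.

Lemma act_ev P (u : ratfun R n) : act P u = ev (@ratx C n) (@dfr C n) P u.
Proof.
apply: eq_bigr => m _; rewrite scale_ratE /mop fop_rx big_enum /= -mulrA.
by [].
Qed.

Lemma Ann_annz (f : {mpoly C[n]}) l P : Ann f l P <-> annz f l P.
Proof. by rewrite /annz -act_ev. Qed.

(** On a convex hull a linear form is bounded below by its least value on the generating points,
    here -t, attained at any monomial of h. *)
Lemma is_ordf_lead (w : 'I_n -> R) (f h : {mpoly C[n]}) t :
  h != 0 -> lead (fun i => - w i) t f h -> is_ordf f w (- t).
Proof.
move=> h0 L; have [L1 L2] := L.
have dot (m : 'X_{1..n}) : dotR (fun i => (m i)%:R) w = - vw (fun i => - w i) m.
  by rewrite vwN opprK; apply: eq_bigr => i _; rewrite mulr_natl.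
have dotS (lam : 'X_{1..n} -> R) g : (forall i, g i = \sum_(m <- msupp f) lam m * (m i)%:R) ->
    dotR g w = \sum_(m <- msupp f) lam m * dotR (fun i => (m i)%:R) w.
  move=> hg; rewrite /dotR; under eq_bigr do rewrite hg mulr_suml.
  rewrite exchange_big; apply: eq_bigr => m _ /=; rewrite mulr_sumr.
  by apply: eq_bigr => i _; rewrite mulrA.
have [m mh] : exists m, m \in msupp h.
  move: h0; rewrite -msupp_eq0; case: (msupp h) => // m s _.
  by exists m; rewrite mem_head.
have mf : m \in msupp f.
  rewrite mcoeff_msupp -(subrK h f) mcoeffD memN_msupp_eq0 ?add0r -?mcoeff_msupp //.
  by apply/negP => /L2; rewrite (eqP (L1 _ mh)) ltxx.
split.
  exists (fun i => (m i)%:R); split; last by rewrite dot (eqP (L1 _ mh)).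
  (* The point mass at m exhibits this exponent as a point of the Newton polytope. *)
  exists (fun m' => (m' == m)%:R); split; first by move=> m'; apply: ler0n.
  have pick (F : 'X_{1..n} -> R) : \sum_(m' <- msupp f) (m' == m)%:R * F m' = F m.
    rewrite (bigD1_seq m) ?msupp_uniq //= eqxx mul1r big1 ?addr0 // => m' /negPf ->.
    by rewrite mul0r.
  split; last by move=> i; rewrite pick.
  by rewrite -[RHS](pick (fun=> 1)); apply: eq_bigr => m' _; rewrite mulr1.
move=> g [lam [lam0 [lam1 /dotS ->]]].
have -> : - t = \sum_(m' <- msupp f) lam m' * - t by rewrite -mulr_suml lam1 mul1r.
rewrite big_seq [X in _ <= X]big_seq; apply: ler_sum => m' m'f.
apply: ler_wpM2l; first exact: lam0.
rewrite dot lerN2; exact: (lead_wle L m'f).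
Qed.

End Transfer.

Theorem mainTheorem3 (R : realType) (n : nat) (f : {mpoly R[i][n]}) (l : int)
    (w : 'I_n -> R) :
  f != 0 -> (exists i, w i != 0) ->
  (exists o, is_ordf f w o /\
     exists b, is_bfun (Ann f l) w b /\ root b (toC (l%:~R * o)))
  /\
  ((0 <= l)%R ->
     exists o, is_ordf f w o /\ is_bfun (Ann f l) w ('X - (toC (l%:~R * o))%:P)).
Proof.
(* The initial form for -w selects the terms of least w-weight, so ord_f(w) = -t. *)
move=> f0 _; have [t fh h0] := lead_ini (fun i => - w i) f0.
have ord := is_ordf_lead h0 fh.
pose iota : {rmorphism R -> R[i]} := real_complex R.
have toCE : @toC R =1 iota by [].
have cE : toC (l%:~R * - t) = iota (- t *~ l) by rewrite toCE mulrzl.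
have JE p : initI w (Ann f l) (peval p (s_op w)) <-> iniI w (annz f l) (pev iota w p).
  by rewrite (peval_pev _ _ toCE); apply: initI_iniI; apply: Ann_annz.
split.
  exists (- t); split; first exact: ord.
  have [b [mb hb]] := annz_bfun iota f0 h0 fh l.
  exists b; split; last by rewrite cE; apply/rootP; apply: (annz_root f0 h0 fh); apply/hb.
  by split=> [|p]; [exact: mb | exact: iff_trans (JE p) (hb p)].
case: l JE cE => // l JE cE _; exists (- t); split; first exact: ord.
rewrite cE; split=> [|p]; first exact: monicXsubC.
exact: iff_trans (JE p) (annz_bfun_nat iota f0 h0 fh l p).
Qed.
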